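(* Let $k$ be a field, let $n\ge 3$, let $\mathscr C=\{j_1,\dots,j_m,i_1,\dots,i_k\}$ be an admissible subchain of $\{1,\dots,n-1\}$, let $\mathfrak C_{2n}$ be the associated category of Dyck paths with exactly $n-1$ peaks, and let $Q$ be the quiver of type $\mathbb A_{n-1}$ whose set of sinks is $\{i_1,\dots,i_k\}$ and whose set of sources is $\{j_1,\dots,j_m\}$. Then the functor $\Theta:\mathfrak C_{2n}\to \mathrm{rep}\,Q$ is an equivalence of categories.
   Context: Words. Fix $n\ge 3$. A Dyck path of length $2n$ is a word $y_1\cdots y_{2n}$ in the letters $U,D$ with $n$ letters of each kind such that every prefix contains at least as many $U$'s as $D$'s; $\mathfrak D_{2n}$ is the set of all of them. Each is written $UWD=Uw_1\cdots w_{n-1}D$ with $w_i=y_{2i}y_{2i+1}\in\{UD,DU,UU,DD\}$. $\mathrm{Supp}(UWD)=\{q: w_q\in\{UD,UU\}\}$. For $1\le i\le n-1$ the map $f_i:\mathfrak D_{2n}\to\mathfrak D_{2n}$ replaces $w_i=ab$ by $ba$ and leaves the other $w_q$ unchanged. A peak is an occurrence of the consecutive letters $UD$. $S$ is the set of Dyck paths of length $2n$ with exactly $n-1$ peaks; $UWD\in S$ exactly when there are $1\le l\le r\le n-1$ with $w_i=UD$ for $l\le i\le r$ and $w_i=DU$ otherwise. Admissible subchains and elementary shifts. An admissible subchain $\mathscr C$ of $\{1,\dots,n-1\}$ is a subset containing $1$ and $n-1$ whose elements, in increasing order, are alternately assigned to two disjoint nonempty classes $I=\{i_1<i_2<\cdots\}$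 and $J=\{j_1<j_2<\cdots\}$. For consecutive elements $c<c'$ of $\mathscr C$ the integer interval $[c,c']$ is a segment, of type $[i,j]$ if $c=i\in I,\ c'=j\in J$, and of type $[j,i]$ if $c=j\in J,\ c'=i\in I$. Given $UWD$, on a segment $[i,j]$ put $t=\min\{s\in[i,j]:w_s=UD\}$ and $p=\min\{s:t<s\le j,\ w_s=DU\}$; on a segment $[j,i]$ put $t=\max\{s\in[j,i]:w_s=UD\}$ and $p=\max\{s:j\le s<t,\ w_s=DU\}$ (when these exist). The elementary shifts from $UWD$ are the following transformations. ES1: on a segment $[i,j]$ with $i\ne1$ on which all $w_s=UD$: if, with $j^-$ the predecessor of $i$ in $\mathscr C$, there is $s$ with $j^-\le s<i$ and $w_x=UD$ for $s\le x\le i$, and, when $j\neq n-1$ and $i^+$ is the successor of $j$ in $\mathscr C$, $w_y=DU$ for $j<y\le i^+$, then apply $f_j\circ\cdots\circ f_i$ (all indices from $i$ to $j$). On a segment $[j,i]$ with $i\ne n-1$ on which all $w_s=UD$: if, with $j^+$ the successor of $i$, there is $s$ with $i<s\le j^+$ and $w_x=UD$ for $i\le x\le s$, and, when $j\ne1$ and $i^-$ is the predecessor of $j$, $w_y=DU$ for $i^-\le y<j$, then apply $f_i\circ\cdots\circ f_j$. ES2: if $t=1$ or $t=n-1$, apply $f_t$. ES3: if $i<t<j$ on a segment $[i,j]$ (resp. $j<t<i$ on a segment $[j,i]$), apply $f_t$. ES4: if $p=j$ on a segment $[i,j]$, apply $f_{i^+}\circ\cdots\circ f_j$ (all indices from $j$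 to $i^+$, the successor of $j$) if $j\ne n-1$, and $f_j$ if $j=n-1$; if $p=j$ on a segment $[j,i]$, apply $f_{i^-}\circ\cdots\circ f_j$ (all indices from $i^-$, the predecessor of $j$, to $j$) if $j\neq1$, and $f_j$ if $j=1$. ES5: if $t<p<j$ on a segment $[i,j]$ (resp. $j<p<t$ on a segment $[j,i]$), apply $f_p$. The category. Fix a field $k$. A shift path from $X$ to $Y$ is a finite (possibly empty, giving the identity) sequence $X=X_0\to X_1\to\cdots\to X_m=Y$ in $\mathfrak D_{2n}$ in which each step is an elementary shift of type ES1–ES5. Length-two shift paths $X\xrightarrow{F}X'\xrightarrow{G}Y$ and $X\xrightarrow{F'}X''\xrightarrow{G'}Y$ with $X'\ne X''$ are identified whenever $G'=F$ and $G=F'$ (equal as compositions of the maps $f_q$), and these identifications are extended compatibly with composition. For Dyck paths $X,Y$, $\mathrm{Hom}(X,Y)$ is the $k$-vector space spanned by shift paths from $X$ to $Y$ modulo these identifications if there are shift paths from $X$ to $Y$ and $\bigcap_q \mathrm{Supp}(X_q)\neq\varnothing$ for each such shift path $(X_q)$; otherwise $\mathrm{Hom}(X,Y)=0$. Composition is concatenation. The category $(\mathfrak D_{2n},R)$ has as objects finite formal direct sums of Dyck paths, with matrices of such morphisms. $\mathfrak C_{2n}$ is the full subcategory of finite direct sums of Dyck paths of $S$. The functor. $Q$ has vertices $1,\dots,n-1$ and one arrow between $s$ and $s+1$ for each $1\le s\le n-2$: $s+1\to s$ if $s,s+1$ lie in a segment of type $[i,j]$, and $s\to s+1$ if they lie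 in a segment of type $[j,i]$. $\mathrm{rep}\,Q$ is the category of finite-dimensional representations over $k$. The $k$-linear additive functor $\Theta$ sends $UWD\in S$ to the representation with $k$ at $s$ if $w_s=UD$, $0$ if $w_s=DU$, the map on the arrow between $s$ and $s+1$ being $1_k$ if $w_s=w_{s+1}=UD$ and $0$ otherwise. An elementary shift $f_{q_2}\circ\cdots\circ f_{q_1}$ (indices $q_1,\dots,q_2$) from $UWD$ to $UVD$ is sent to the morphism whose component at $s$ is $0$ for $q_1\le s\le q_2$, and for other $s$ is $1_k$ if $w_s=v_s=UD$ and $0$ otherwise; this is extended by composition, linearity and direct sums. *)

(* Defs.v *)
From HB Require Import structures.
From mathcomp Require Import all_boot all_order all_algebra.
From mathcomp Require Import finmap boolp.
From mathcomp Require Import zify.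
From mathcomp.multinomials Require Import monalg.

Set Implicit Arguments.
Unset Strict Implicit.
Unset Printing Implicit Defensive.

Import GRing.Theory.
Local Open Scope ring_scope.
Local Open Scope quotient_scope.

(* Composition is in diagrammatic order throughout: [hcomp f g] and [lcomp f g]
   are "first f, then g". *)
Record category := Category {
  obj :> Type;
  hom : obj -> obj -> Type;
  idm : forall X, hom X X;
  hcomp : forall X Y Z, hom X Y -> hom Y Z -> hom X Z;
  comp_assoc : forall X Y Z T (f : hom X Y) (g : hom Y Z) (h : hom Z T),
    hcomp f (hcomp g h) = hcomp (hcomp f g) h;
  comp_idl : forall X Y (f : hom X Y), hcomp (idm X) f = f;
  comp_idr : forall X Y (f : hom X Y), hcomp f (idm Y) = f }.
Arguments idm {c} X.

Record functor (C E : category) := Functor {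
  fobj :> C -> E;
  fmor : forall X Y, hom X Y -> hom (fobj X) (fobj Y);
  fmor_id : forall X, fmor (idm X) = idm (fobj X);
  fmor_comp : forall X Y Z (f : hom X Y) (g : hom Y Z),
    fmor (hcomp f g) = hcomp (fmor f) (fmor g) }.

Program Definition id_functor (C : category) : functor C C :=
  @Functor C C (fun X => X) (fun X Y f => f) _ _.

Program Definition comp_functor (C E K : category)
    (F : functor C E) (G : functor E K) : functor C K :=
  @Functor C K (fun X => G (F X)) (fun X Y f => fmor G (fmor F f)) _ _.
Next Obligation. by move=> *; rewrite !fmor_id. Qed.
Next Obligation. by move=> *; rewrite !fmor_comp. Qed.

Definition is_iso (C : category) (X Y : C) (f : hom X Y) : Prop :=
  exists g : hom Y X, hcomp f g = idm X /\ hcomp g f = idm Y.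

Definition nat_isomorphic (C E : category) (F G : functor C E) : Prop :=
  exists eta : forall X, hom (F X) (G X),
    (forall X, is_iso (eta X)) /\
    (forall X Y (f : hom X Y),
      hcomp (fmor F f) (eta Y) = hcomp (eta X) (fmor G f)).

Definition is_equivalence (C E : category) (F : functor C E) : Prop :=
  exists G : functor E C,
    nat_isomorphic (comp_functor F G) (id_functor C) /\
    nat_isomorphic (comp_functor G F) (id_functor E).

Program Definition full_subcategory (C : category) (P : C -> Prop) :=
  @Category {X : C | P X} (fun X Y => hom (sval X) (sval Y))
    (fun X => idm (sval X)) (fun X Y Z f g => hcomp f g) _ _ _.
Next Obligation. by move=> *; rewrite comp_assoc. Qed.
Next Obligation. by move=> *; rewrite comp_idl. Qed.
Next Obligation. by move=> *; rewrite comp_idr. Qed.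

Record lincategory (k : fieldType) := LinCategory {
  lobj :> Type;
  lhom : lobj -> lobj -> lmodType k;
  lid : forall X, lhom X X;
  lcomp : forall X Y Z, lhom X Y -> lhom Y Z -> lhom X Z;
  lcomp_linearl : forall X Y Z (g : lhom Y Z),
    linear (fun f : lhom X Y => lcomp f g);
  lcomp_linearr : forall X Y Z (f : lhom X Y),
    linear (fun g : lhom Y Z => lcomp f g);
  lcomp_assoc : forall X Y Z T (f : lhom X Y) (g : lhom Y Z) (h : lhom Z T),
    lcomp f (lcomp g h) = lcomp (lcomp f g) h;
  lcomp_idl : forall X Y (f : lhom X Y), lcomp (lid X) f = f;
  lcomp_idr : forall X Y (f : lhom X Y), lcomp f (lid Y) = f }.
Arguments lid {k l} X.

Section AdditiveCompletion.
Variables (k : fieldType) (A : lincategory k).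

Record formal_sum := FormalSum {
  nsummands : nat;
  summand :> 'I_nsummands -> A }.

(* Row index: summand of the source; column index: summand of the target. *)
Definition mx_hom (X Y : formal_sum) : Type :=
  forall i j, lhom (X i) (Y j).

Definition mx_id (X : formal_sum) : mx_hom X X := fun i j =>
  if @eqP _ i j is ReflectT e
  then ecast j' (lhom (X i) (X j')) e (lid (X i)) else 0.

Definition mx_comp (X Y Z : formal_sum)
    (f : mx_hom X Y) (g : mx_hom Y Z) : mx_hom X Z :=
  fun i l => \sum_j lcomp (f i j) (g j l).

Let compl X Y Z (g : lhom Y Z) (f : lhom X Y) := lcomp (l := A) f g.
Let compr X Y Z (f : lhom X Y) (g : lhom Y Z) := lcomp (l := A) f g.
HB.instance Definition _ X Y Z g := GRing.isLinear.Build k _ _ _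
  (@compl X Y Z g) (@lcomp_linearl _ _ _ _ _ g).
HB.instance Definition _ X Y Z f := GRing.isLinear.Build k _ _ _
  (@compr X Y Z f) (@lcomp_linearr _ _ _ _ _ f).

Lemma mx_idii X i : @mx_id X i i = lid (X i).
Proof. by rewrite /mx_id; case: eqP => // e; rewrite eq_axiomK. Qed.

Lemma mx_id_neq X i j : i != j -> @mx_id X i j = 0.
Proof. by rewrite /mx_id; case: eqP. Qed.

Lemma mx_comp_assoc X Y Z T
    (f : mx_hom X Y) (g : mx_hom Y Z) (h : mx_hom Z T) :
  mx_comp f (mx_comp g h) = mx_comp (mx_comp f g) h.
Proof.
apply/functional_extensionality_dep => i.
apply/functional_extensionality_dep => l; rewrite /mx_comp.
under eq_bigr do rewrite -[lcomp _ _]/(compr _ _) linear_sum /=.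
rewrite exchange_big /=; apply: eq_bigr => j _.
rewrite -[RHS]/(compl _ _) linear_sum /=.
by apply: eq_bigr => m _; rewrite /compr /compl lcomp_assoc.
Qed.

Lemma mx_comp_idl X Y (f : mx_hom X Y) : mx_comp (@mx_id X) f = f.
Proof.
apply/functional_extensionality_dep => i.
apply/functional_extensionality_dep => l; rewrite /mx_comp.
rewrite (bigD1 i) //= mx_idii lcomp_idl big1 ?addr0 // => j ji.
by rewrite mx_id_neq 1?eq_sym // -[lcomp _ _]/(compl _ _) linear0.
Qed.

Lemma mx_comp_idr X Y (f : mx_hom X Y) : mx_comp f (@mx_id Y) = f.
Proof.
apply/functional_extensionality_dep => i.
apply/functional_extensionality_dep => l; rewrite /mx_comp.
rewrite (bigD1 l) //= mx_idii lcomp_idr big1 ?addr0 // => j ji.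
by rewrite mx_id_neq // -[lcomp _ _]/(compr _ _) linear0.
Qed.

Definition additive_completion : category :=
  Category mx_comp_assoc mx_comp_idl mx_comp_idr.

End AdditiveCompletion.

Record quiver := Quiver {
  vertex :> Type;
  arrow : vertex -> vertex -> Type }.

Section Representations.
Variables (k : fieldType) (Q : quiver).

Record rep := Rep {
  rep_space :> Q -> vectType k;
  rep_map : forall u v, arrow u v -> 'Hom(rep_space u, rep_space v) }.

Record rep_hom (M N : rep) := RepHom {
  rep_comp :> forall v, 'Hom(M v, N v);
  rep_comm : forall u v (a : arrow u v),
    (rep_comp v \o rep_map M a = rep_map N a \o rep_comp u)%VF }.

Lemma rep_hom_eq M N (f g : rep_hom M N) : (forall v, f v = g v) -> f = g.
Proof.
case: f g => [f fc] [g gc] /= fg.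
have {}fg : f = g by apply: functional_extensionality_dep.
by case: _ / fg in gc *; congr RepHom; apply: Prop_irrelevance.
Qed.

Program Definition rep_id M : rep_hom M M := @RepHom M M (fun v => \1%VF) _.
Next Obligation. by rewrite comp_lfun1l comp_lfun1r. Qed.

Program Definition rep_mul M N P (f : rep_hom M N) (g : rep_hom N P) :
  rep_hom M P := @RepHom M P (fun v => g v \o f v)%VF _.
Next Obligation.
by rewrite -comp_lfunA rep_comm comp_lfunA rep_comm comp_lfunA.
Qed.

Program Definition rep_category : category :=
  @Category rep rep_hom rep_id rep_mul _ _ _.
Next Obligation. by move=> *; apply: rep_hom_eq => v /=; rewrite comp_lfunA. Qed.
Next Obligation. by move=> *; apply: rep_hom_eq => v /=; rewrite comp_lfun1r. Qed.
Next Obligation. by move=> *; apply: rep_hom_eq => v /=; rewrite comp_lfun1l. Qed.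

End Representations.

Section DyckPaths.
Local Open Scope nat_scope.
Variable n : nat.

Local Notation U := true.
Local Notation D := false.

Definition is_dyck (y : (n.*2).-tuple bool) : bool :=
  (count_mem U y == n) &&
  [forall m : 'I_(n.*2).+1, count_mem D (take m y) <= count_mem U (take m y)]%N.

Record dyck := Dyck { word :> (n.*2).-tuple bool; _ : is_dyck word }.
HB.instance Definition _ := [isSub for word].
HB.instance Definition _ := [Choice of dyck by <:].

Definition peaks (X : dyck) : nat :=
  count (fun p => (nth D X p == U) && (nth D X p.+1 == D)) (iota 0 n.*2.-1).

Definition in_S (X : dyck) : Prop := peaks X = n.-1.

(* All indices are shifted down by one: the letter y_p is [nth D X p.-1], and
   q in {1, ..., n-1} is the ordinal s = q - 1 below n - 1, so that
   w_q = y_{2q} y_{2q+1} reads letters 2s+1 and 2s+2. *)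
Local Notation V := 'I_n.-1.

Definition block (X : dyck) (s : V) : bool * bool :=
  (nth D X s.*2.+1, nth D X s.*2.+2).

Definition UD (X : dyck) (s : V) : bool := block X s == (U, D).
Definition DU (X : dyck) (s : V) : bool := block X s == (D, U).

Definition Supp (X : dyck) : {set V} :=
  [set s | block X s \in [:: (U, D); (U, U)]].

Definition swap_pos (s p : nat) : nat :=
  if p == s.*2.+1 then s.*2.+2 else if p == s.*2.+2 then s.*2.+1 else p.

Definition swap_word (s : V) (y : (n.*2).-tuple bool) : (n.*2).-tuple bool :=
  [tuple of mkseq (fun p => nth D y (swap_pos s p)) n.*2].

Let heightE (y : (n.*2).-tuple bool) m : (m <= n.*2)%N ->
  count_mem U (take m y) = \sum_(0 <= p < m) nth D y p.
Proof.
move=> mn; rewrite -sum1_count (big_nth D) big_mkcond /=.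
have -> : size (take m y) = m by rewrite size_takel // size_tuple.
rewrite [LHS]big_nat [RHS]big_nat; apply: eq_bigr => p pm.
by rewrite nth_take //; case: nth.
Qed.

Let countUD (s : seq bool) : (count_mem U s + count_mem D s = size s)%N.
Proof. by elim: s => //= -[] s /= <-; lia. Qed.

Lemma is_dyckP (y : (n.*2).-tuple bool) :
  reflect (\sum_(0 <= p < n.*2) nth D y p = n /\
           forall m, (m <= n.*2)%N -> (m <= (\sum_(0 <= p < m) nth D y p).*2)%N)
          (is_dyck y).
Proof.
rewrite /is_dyck.
have -> : count_mem U y = (\sum_(0 <= p < n.*2) nth D y p)%N.
  by rewrite -heightE // take_oversize // size_tuple.
have E m : (m <= n.*2)%N -> (count_mem D (take m y) <= count_mem U (take m y))%N =
    (m <= (\sum_(0 <= p < m) nth D y p).*2)%N.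
  move=> mn; rewrite -heightE //; have := countUD (take m y).
  by rewrite size_takel ?size_tuple //; lia.
apply: (iffP andP) => -[/eqP h1 h2]; split.
- by [].
- move=> m mn; rewrite -E //.
  by have /forallP/(_ (Ordinal (mn : (m < n.*2.+1)%N))) := h2.
- by rewrite h1.
- by apply/forallP => m; rewrite E ?h2 // -ltnS.
Qed.

Let swap_sum (s : V) (y : (n.*2).-tuple bool) m : (m <= n.*2)%N -> m != s.*2.+2 ->
  (\sum_(0 <= p < m) nth D (swap_word s y) p = \sum_(0 <= p < m) nth D y p)%N.
Proof.
move=> mn ms.
have E p : (p < m)%N -> nth D (swap_word s y) p = nth D y (swap_pos s p).
  by move=> pm; rewrite nth_mkseq //; lia.
rewrite big_nat; under eq_bigr => p pm do rewrite E //.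
rewrite -big_nat.
have Ile a b : (forall p, (a <= p < b)%N -> swap_pos s p = p) ->
    (\sum_(a <= p < b) nth D y (swap_pos s p) = \sum_(a <= p < b) nth D y p)%N.
  by move=> h; rewrite [LHS]big_nat [RHS]big_nat; apply: eq_bigr => p /h ->.
have [h|h] := leqP m s.*2.+1.
  by apply: Ile => p pm; rewrite /swap_pos !ifF //; lia.
have h3 : (s.*2.+3 <= m)%N by lia.
rewrite !(@big_cat_nat _ _ _ s.*2.+3 0 m) //=; congr addn; last first.
  by apply: Ile => p pm; rewrite /swap_pos !ifF //; lia.
rewrite !big_nat_recr //= Ile; last first.
  by move=> p pm; rewrite /swap_pos !ifF //; lia.
have [-> -> ->] : [/\ swap_pos s s.*2 = s.*2, swap_pos s s.*2.+1 = s.*2.+2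
    & swap_pos s s.*2.+2 = s.*2.+1].
  by rewrite /swap_pos; split; do !case: eqP; lia.
by rewrite -!addnA; do 2!congr addn; rewrite addnC.
Qed.

Fact swap_is_dyck s (X : dyck) : is_dyck (swap_word s X).
Proof.
case: X => y /= /is_dyckP[h1 h2]; have sn := ltn_ord s.
apply/is_dyckP; split; first by rewrite swap_sum //; lia.
move=> m mn; have [->|ms] := eqVneq m s.*2.+2; last by rewrite swap_sum ?h2.
rewrite big_nat_recr //= swap_sum; [|lia|lia].
by have := h2 s.*2.+1; lia.
Qed.

Definition f_ (s : V) (X : dyck) : dyck := Dyck (swap_is_dyck s X).

(* f_b o ... o f_a; the enumeration of the ordinals is increasing. *)
Definition f_range (a b : V) (X : dyck) : dyck :=
  foldl (fun Y s => f_ s Y) X [seq s <- enum V | a <= (s : V) <= b].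

Lemma block_f s X u : block (f_ s X) u =
  if u == s then ((block X u).2, (block X u).1) else block X u.
Proof.
have un := ltn_ord u; have sn := ltn_ord s.
rewrite /block /= !nth_mkseq; [|lia|lia].
rewrite /swap_pos -(inj_eq val_inj) /=.
case: (@eqP _ (u : nat) s) => [->|us].
  by do !case: eqP => //=; lia.
by do !case: eqP => //=; lia.
Qed.

Lemma block_f_range a b X u : block (f_range a b X) u =
  if (a <= u <= b)%N then ((block X u).2, (block X u).1) else block X u.
Proof.
rewrite /f_range; have : uniq [seq s <- enum V | a <= (s : V) <= b].
  by rewrite filter_uniq ?enum_uniq.
have -> : (a <= u <= b)%N = (u \in [seq s <- enum V | a <= (s : V) <= b]).
  by rewrite mem_filter mem_enum andbT.
elim: (filter _ _) X => [|s l IH] X //= /andP[sl ul].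
rewrite IH // block_f inE; case: eqVneq => [->|us]; first by rewrite (negPf sl).
by [].
Qed.

Definition UD_interval (X : dyck) (l r : nat) : Prop :=
  forall s : V, block X s = if (l <= s < r)%N then (U, D) else (D, U).

Lemma in_S_interval X : 0 < n -> in_S X ->
  exists l r, l < r <= n.-1 /\ UD_interval X l r.
Proof.
move=> ngt0; rewrite /in_S; case: X => y ydyck.
rewrite /peaks /UD_interval /block /=.
have /is_dyckP[h1 h2] := ydyck; set Y := nth D y in h1 h2 *.
have Y0 : Y 0%N = U.
  by have := h2 1%N; rewrite big_nat1; case: (Y 0%N) => //; lia.
have YL : Y n.*2.-1 = D.
  have := h2 n.*2.-1; move: h1.
  rewrite -{1}[n.*2]prednK; last by lia.
  by rewrite big_nat_recr //=; case: (Y n.*2.-1); lia.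
rewrite -sum1_count big_mkcond /= => pk.
have pkE : (\sum_(0 <= p < n.*2.-1) (Y p && ~~ Y p.+1) = n.-1)%N.
  rewrite -pk /index_iota subn0; apply: eq_bigr => p _.
  by case: (Y p) (Y p.+1) => -[].
have sU : (\sum_(0 <= p < n.*2.-1) Y p = n)%N.
  move: h1; rewrite -{1}[n.*2]prednK; last by lia.
  by rewrite big_nat_recr //= YL addn0.
have sU1 : (\sum_(0 <= p < n.*2.-1) Y p.+1 = n.-1)%N.
  move: h1; rewrite -{1}[n.*2]prednK; last by lia.
  by rewrite big_nat_recl //= Y0 /=; lia.
have uu : (\sum_(0 <= p < n.*2.-1) (Y p && Y p.+1) = 1)%N.
  suff : (\sum_(0 <= p < n.*2.-1) (Y p && Y p.+1) + n.-1 = n)%N by lia.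
  rewrite -pkE -[RHS]sU -big_split /=; apply: eq_bigr => p _.
  by case: (Y p) (Y p.+1) => -[].
have dd : (\sum_(0 <= p < n.*2.-1) (~~ Y p && ~~ Y p.+1) = 1)%N.
  suff : \sum_(0 <= p < n.*2.-1) (~~ Y p && ~~ Y p.+1) +
      \sum_(0 <= p < n.*2.-1) (Y p && ~~ Y p.+1) +
      \sum_(0 <= p < n.*2.-1) Y p.+1 = n.*2.-1 by lia.
  rewrite -!big_split /=.
  rewrite -[RHS]muln1 -[in RHS](subn0 n.*2.-1) -sum_nat_const_nat.
  by apply: eq_bigr => p _; case: (Y p) (Y p.+1) => -[].
have uniq1 (g : nat -> bool) N : (\sum_(0 <= p < N) g p = 1)%N ->
    exists2 p0, (p0 < N)%N & forall p, (p < N)%N -> g p = (p == p0).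
  elim: N => [|N IH]; first by rewrite big_nil.
  rewrite big_nat_recr //=; case gN: (g N).
    rewrite addn1 => -[] /eqP.
    rewrite big_mkord sum_nat_eq0 => /forallP h; exists N => // p.
    rewrite ltnS leq_eqVlt => /orP[/eqP -> |pN]; first by rewrite eqxx.
    by have := h (Ordinal pN) => /= /eqP; case: (g p) => // _; lia.
  rewrite addn0 => /IH[p0 p0N h]; exists p0; first by lia.
  move=> p; rewrite ltnS leq_eqVlt => /orP[/eqP -> |/h //].
  by rewrite gN; lia.
have [k1 k1N hk1] := uniq1 _ _ uu; have [k2 k2N hk2] := uniq1 _ _ dd.
have stepE p : (p < n.*2.-1)%N -> Y p.+1 (+) odd p.+1 =
    (Y p (+) odd p) (+) ((p == k1) || (p == k2)).
  move=> pN; rewrite -hk1 // -hk2 //=.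
  by case: (Y p) (Y p.+1) (odd p) => -[] [].
have alt p : (p <= n.*2.-1)%N ->
    Y p (+) odd p = ~~ ((k1 < p)%N (+) (k2 < p)%N).
  elim: p => [|p IH] pN; first by rewrite Y0.
  rewrite stepE // IH; last by lia.
  have k12 : k1 != k2.
    apply/eqP => e; have := hk1 _ k1N; have := hk2 _ k2N.
    by rewrite e !eqxx; case: (Y k2).
  by do 2!case: ltngtP; lia.
have k12 : (k1 < k2)%N.
  rewrite ltnNge; apply/negP => k21.
  have Ek p : (p <= k2)%N -> Y p = ~~ odd p.
    by move=> pk2; have := alt p; case: (Y p) (odd p) => -[]; lia.
  have := h2 k2.+2; rewrite big_nat_recr //=.
  have -> : Y k2.+1 = D.
    have := hk2 _ k2N; rewrite eqxx; case: (Y k2.+1) => //.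
    by rewrite andbF.
  rewrite addn0 big_nat.
  under eq_bigr => p pk2 do rewrite Ek //.
  rewrite -big_nat.
  have sumodd m : (\sum_(0 <= p < m) ~~ odd p = uphalf m)%N.
    elim: m => [|m IH]; first by rewrite big_nil.
    by rewrite big_nat_recr //= IH uphalf_half; lia.
  rewrite sumodd.
  have : odd k2.
    by have := hk2 _ k2N; rewrite eqxx Ek //; case: odd.
  by lia.
have e1 : ~~ odd k1.
  have := hk1 _ k1N; rewrite eqxx => /andP[Yk _].
  by have := alt k1; rewrite Yk; lia.
have e2 : ~~ odd k2.
  have := hk2 _ k2N; rewrite eqxx => /andP[Yk _].
  by have := alt k2; rewrite (negPf Yk); lia.
exists k1./2, k2./2; split; first by lia.
move=> s; have sn := ltn_ord s.
have /= := alt s.*2.+1 ltac:(lia); have /= := alt s.*2.+2 ltac:(lia).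
have -> : (k1 < s.*2.+1) = (k1./2 <= s) by lia.
have -> : (k2 < s.*2.+1) = (k2./2 <= s) by lia.
have -> : (k1 < s.*2.+2) = (k1./2 <= s) by lia.
have -> : (k2 < s.*2.+2) = (k2./2 <= s) by lia.
have : (k2./2 <= s) ==> (k1./2 <= s) by lia.
rewrite odd_double /= (ltnNge s).
by case: (Y s.*2.+1) (Y s.*2.+2) (k1./2 <= s) (k2./2 <= s) => -[] [] [].
Qed.

End DyckPaths.

Section Lift.
Variables (k : fieldType) (T : choiceType).

Definition free_lift (M : lmodType k) (h : T -> M) (f : {malg k[T]}) : M :=
  \sum_(b <- msupp f) f@_b *: h b.

Lemma lift_sub (M : lmodType k) (h : T -> M) f (S : {fset T}) :
  fsubset (msupp f) S -> free_lift h f = \sum_(b <- S) f@_b *: h b.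
Proof.
move=> sub; apply/big_fset_incl => // b _ bf.
by rewrite mcoeff_outdom // scale0r.
Qed.

Lemma lift_linear (M : lmodType k) (h : T -> M) : linear (free_lift h).
Proof.
move=> a f g; pose S := (msupp f `|` msupp g `|` msupp (a *: f + g))%fset.
rewrite !(@lift_sub _ h _ S); try by apply/fsubsetP => x; rewrite !inE => ->; rewrite ?orbT.
rewrite scaler_sumr -big_split /=; apply: eq_bigr => b _.
by rewrite mcoeffD mcoeffZ scalerDl scalerA.
Qed.

Lemma lift1 (M : lmodType k) (h : T -> M) b : free_lift h << b >> = h b.
Proof.
by rewrite (@lift_sub _ _ _ [fset b]%fset) ?msuppU_le // big_seq_fset1 mcoeffUU scale1r.
Qed.

Lemma linear_malg_ext (M : lmodType k) (u v : {malg k[T]} -> M) :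
  linear u -> linear v -> (forall b, u << b >> = v << b >>) -> u =1 v.
Proof.
move=> lu lv uv f.
pose U := HB.pack_for {linear {malg k[T]} -> M} u (GRing.isLinear.Build _ _ _ _ u lu).
pose W := HB.pack_for {linear {malg k[T]} -> M} v (GRing.isLinear.Build _ _ _ _ v lv).
rewrite -[u f]/(U f) -[v f]/(W f) [f]monalgE !linear_sum; apply: eq_bigr => b _.
have -> : << f@_b *g b >> = f@_b *: << b >> :> {malg k[T]}.
  by apply/malgP => c; rewrite mcoeffZ !mcoeffU mulr_natr.
by rewrite !linearZ /= uv.
Qed.

End Lift.

Section Shifts.
Variables (n : nat) (I J : {set 'I_n.-1}).
Local Notation V := 'I_n.-1.
Local Notation dyck := (dyck n).
Local Open Scope nat_scope.

Definition consecutive (c c' : V) : Prop :=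
  [/\ c \in I :|: J, c' \in I :|: J, c < c'
    & forall x, x \in I :|: J -> ~~ (c < x < c')].

Definition seg_ij (i j : V) : Prop := [/\ i \in I, j \in J & consecutive i j].
Definition seg_ji (j i : V) : Prop := [/\ j \in J, i \in I & consecutive j i].

Definition is_first (s : V) : bool := s == 0 :> nat.
Definition is_last (s : V) : bool := s.+1 == n.-1.

Definition admissible : Prop :=
  [/\ [disjoint I & J], I != set0, J != set0,
      (exists2 c, c \in I :|: J & is_first c) /\
      (exists2 c, c \in I :|: J & is_last c)
    & forall c c', consecutive c c' -> seg_ij c c' \/ seg_ji c c'].

Definition t_ij (X : dyck) (i j t : V) : Prop :=
  [/\ i <= t <= j, UD X t & forall s : V, i <= s <= j -> UD X s -> t <= s].
Definition p_ij (X : dyck) (j t p : V) : Prop :=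
  [/\ t < p <= j, DU X p & forall s : V, t < s <= j -> DU X s -> p <= s].
Definition t_ji (X : dyck) (j i t : V) : Prop :=
  [/\ j <= t <= i, UD X t & forall s : V, j <= s <= i -> UD X s -> s <= t].
Definition p_ji (X : dyck) (j t p : V) : Prop :=
  [/\ j <= p < t, DU X p & forall s : V, j <= s < t -> DU X s -> s <= p].

(* [elem_shift X a b]: the map f_b o ... o f_a is an elementary shift from X.
   A chain element has a predecessor (successor) exactly when it is not the
   first (last) vertex, so that requirements of the form "i is not 1" and "if j
   is not n-1" are carried by the existence of, resp. the quantification over,
   a neighbouring segment. *)
Inductive elem_shift (X : dyck) : V -> V -> Prop :=
| ES1_ij i j j' : seg_ij i j -> (forall x : V, i <= x <= j -> UD X x) ->
    seg_ji j' i ->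
    (exists2 s : V, j' <= s < i & forall x : V, s <= x <= i -> UD X x) ->
    (forall i', seg_ji j i' -> forall y : V, j < y <= i' -> DU X y) ->
    elem_shift X i j
| ES1_ji j i j' : seg_ji j i -> (forall x : V, j <= x <= i -> UD X x) ->
    seg_ij i j' ->
    (exists2 s : V, i < s <= j' & forall x : V, i <= x <= s -> UD X x) ->
    (forall i', seg_ij i' j -> forall y : V, i' <= y < j -> DU X y) ->
    elem_shift X j i
| ES2_ij i j t : seg_ij i j -> t_ij X i j t -> is_first t || is_last t ->
    elem_shift X t t
| ES2_ji j i t : seg_ji j i -> t_ji X j i t -> is_first t || is_last t ->
    elem_shift X t t
| ES3_ij i j t : seg_ij i j -> t_ij X i j t -> i < t < j -> elem_shift X t t
| ES3_ji j i t : seg_ji j i -> t_ji X j i t -> j < t < i -> elem_shift X t t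
| ES4_ij i j t i' : seg_ij i j -> t_ij X i j t -> p_ij X j t j ->
    seg_ji j i' -> elem_shift X j i'
| ES4_ij_last i j t : seg_ij i j -> t_ij X i j t -> p_ij X j t j ->
    is_last j -> elem_shift X j j
| ES4_ji j i t i' : seg_ji j i -> t_ji X j i t -> p_ji X j t j ->
    seg_ij i' j -> elem_shift X i' j
| ES4_ji_first j i t : seg_ji j i -> t_ji X j i t -> p_ji X j t j ->
    is_first j -> elem_shift X j j
| ES5_ij i j t p : seg_ij i j -> t_ij X i j t -> p_ij X j t p -> p < j ->
    elem_shift X p p
| ES5_ji j i t p : seg_ji j i -> t_ji X j i t -> p_ji X j t p -> j < p ->
    elem_shift X p p.

(* The label F = (a, b) stands for the map f_b o ... o f_a.  Distinct intervals
   of indices give distinct maps, so equality of labels is equality of maps. *)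
Definition shift (X : dyck) (F : V * V) (X' : dyck) : Prop :=
  elem_shift X F.1 F.2 /\ X' = f_range F.1 F.2 X.

Inductive spath : dyck -> dyck -> Type :=
| sp_nil X : spath X X
| sp_cons X F X' Y : shift X F X' -> spath X' Y -> spath X Y.

Fixpoint sp_cat X Y Z (p : spath X Y) : spath Y Z -> spath X Z :=
  match p with
  | sp_nil _ => fun q => q
  | sp_cons _ _ _ _ a p' => fun q => sp_cons a (sp_cat p' q)
  end.

Definition sp_two X F X' G Y (a : shift X F X') (b : shift X' G Y) : spath X Y :=
  sp_cons a (sp_cons b (sp_nil Y)).

Inductive sp_eq : forall X Y, spath X Y -> spath X Y -> Prop :=
| sp_square X X' X'' Y F G (a : shift X F X') (b : shift X' G Y)
    (c : shift X G X'') (d : shift X'' F Y) :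
    X' <> X'' -> sp_eq (sp_two a b) (sp_two c d)
| sp_congr X Y Z (p p' : spath X Y) (q q' : spath Y Z) :
    sp_eq p p' -> sp_eq q q' -> sp_eq (sp_cat p q) (sp_cat p' q')
| sp_refl X Y (p : spath X Y) : sp_eq p p
| sp_sym X Y (p q : spath X Y) : sp_eq p q -> sp_eq q p
| sp_trans X Y (p q r : spath X Y) : sp_eq p q -> sp_eq q r -> sp_eq p r.

Fixpoint common_supp X Y (p : spath X Y) : {set V} :=
  match p with
  | sp_nil X => Supp X
  | sp_cons X _ _ _ _ p' => Supp X :&: common_supp p'
  end.

Definition nonvanishing (X Y : dyck) : Prop :=
  forall p : spath X Y, common_supp p != set0.

Definition sp_rel X Y (p q : {classic spath X Y}) : bool := `[< sp_eq p q >].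

Fact sp_rel_refl X Y : reflexive (@sp_rel X Y).
Proof. by move=> p; apply/asboolP; apply: sp_refl. Qed.
Fact sp_rel_sym X Y : symmetric (@sp_rel X Y).
Proof. by move=> p q; apply/asboolP/asboolP; apply: sp_sym. Qed.
Fact sp_rel_trans X Y : transitive (@sp_rel X Y).
Proof.
move=> q p r /asboolP pq /asboolP qr; apply/asboolP; exact: sp_trans pq qr.
Qed.

Canonical sp_equiv X Y :=
  EquivRel (@sp_rel X Y) (@sp_rel_refl X Y) (@sp_rel_sym X Y) (@sp_rel_trans X Y).

(* Shift paths modulo the identifications; [{classic _}] only provides the
   choice structure that quotient types require. *)
Definition sp_class (X Y : dyck) := {eq_quot @sp_equiv X Y}.

Definition cls X Y (p : spath X Y) : sp_class X Y := \pi p.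

Definition rpr X Y (c : sp_class X Y) : spath X Y := repr c.

Definition cls_cat X Y Z (c : sp_class X Y) (d : sp_class Y Z) : sp_class X Z :=
  cls (sp_cat (rpr c) (rpr d)).

(* A basis of Hom(X, Y): empty as soon as some shift path from X to Y has an
   empty common support, or when there is no shift path at all. *)
Definition hom_basis (X Y : dyck) : choiceType :=
  {c : sp_class X Y | `[< nonvanishing X Y >]}.

Lemma clsP X Y (p q : spath X Y) : cls p = cls q <-> sp_eq p q.
Proof.
split=> [/eqquotP/asboolP //|pq]; by apply/eqquotP/asboolP.
Qed.

Lemma rprK X Y (c : sp_class X Y) : cls (rpr c) = c.
Proof. exact: reprK. Qed.

Lemma rpr_cls X Y (p : spath X Y) : sp_eq (rpr (cls p)) p.
Proof. by apply/clsP; rewrite rprK. Qed.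

Lemma cls_catE X Y Z (p : spath X Y) (q : spath Y Z) :
  cls_cat (cls p) (cls q) = cls (sp_cat p q).
Proof. by apply/clsP/sp_congr; apply: rpr_cls. Qed.

Lemma sp_cat_nil X Y (p : spath X Y) : sp_cat p (sp_nil Y) = p.
Proof. by elim: p => //= ? ? ? ? ? p ->. Qed.

Lemma sp_catA X Y Z T (p : spath X Y) (q : spath Y Z) (r : spath Z T) :
  sp_cat p (sp_cat q r) = sp_cat (sp_cat p q) r.
Proof. by elim: p q => //= ? ? ? ? ? p IH q; rewrite IH. Qed.

Lemma common_supp_cat X Y Z (p : spath X Y) (q : spath Y Z) :
  common_supp (sp_cat p q) = common_supp p :&: common_supp q.
Proof.
elim: p q => [W|W F W' Y' a p IH] q /=; last by rewrite IH setIA.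
apply/esym/setIidPr; case: q => [W'|W' *] //=; exact: subsetIl.
Qed.

Lemma nonvanishingW X Y Z : nonvanishing X Z -> spath X Y -> spath Y Z ->
  nonvanishing X Y /\ nonvanishing Y Z.
Proof.
move=> nz p q; split=> r; [have := nz (sp_cat r q)|have := nz (sp_cat p r)];
  rewrite common_supp_cat; apply: contraNneq => ->; by rewrite ?setI0 ?set0I.
Qed.

End Shifts.

Section DyckCategories.
Variables (k : fieldType) (n : nat) (I J : {set 'I_n.-1}).
Local Notation dyck := (dyck n).
Local Notation spath := (spath I J).
Local Notation sp_class := (sp_class I J).
Local Notation hom_basis := (hom_basis I J).
Local Notation nonvanishing := (nonvanishing I J).

Definition dyck_hom (X Y : dyck) : lmodType k := {malg k[hom_basis X Y]}.

(* The morphism given by a class of shift paths; it is 0 if Hom(X, Y) is. *)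
Definition sp_hom X Y (c : sp_class X Y) : dyck_hom X Y :=
  if insub c is Some b then << (b : hom_basis X Y) >> else 0.

Definition dyck_id X : dyck_hom X X := sp_hom (cls (sp_nil I J X)).

Definition dyck_comp X Y Z (f : dyck_hom X Y) (g : dyck_hom Y Z) :
    dyck_hom X Z :=
  free_lift (fun b => free_lift (fun c => sp_hom (cls_cat (val b) (val c))) g) f.

Lemma sp_hom_val X Y (b : hom_basis X Y) : << b >> = sp_hom (val b).
Proof. by rewrite /sp_hom valK. Qed.

Lemma sp_hom0 X Y (c : sp_class X Y) : ~ nonvanishing X Y -> sp_hom c = 0.
Proof. by move=> nz; rewrite /sp_hom insubF //; apply/asboolPn. Qed.

Lemma sp_hom1 X Y (c : sp_class X Y) (nz : `[< nonvanishing X Y >]) :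
  sp_hom c = << (exist _ c nz : hom_basis X Y) >>.
Proof. by rewrite /sp_hom insubT. Qed.

Lemma dyck_comp_linearl X Y Z (g : dyck_hom Y Z) :
  linear (fun f : dyck_hom X Y => dyck_comp f g).
Proof. exact: lift_linear. Qed.

Lemma dyck_comp_linearr X Y Z (f : dyck_hom X Y) :
  linear (fun g : dyck_hom Y Z => dyck_comp f g).
Proof.
move=> a g h; rewrite /dyck_comp {1 3 5}/free_lift scaler_sumr -big_split /=.
by apply: eq_bigr => b _; rewrite lift_linear scalerDr !scalerA mulrC.
Qed.

Lemma sp_hom_comp X Y Z (c : sp_class X Y) (d : sp_class Y Z) :
  dyck_comp (sp_hom c) (sp_hom d) = sp_hom (cls_cat c d).
Proof.
have [/asboolP nz|nz] := boolP `[< nonvanishing X Z >].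
  have [/asboolP xy /asboolP yz] := nonvanishingW nz (rpr c) (rpr d).
  by rewrite (sp_hom1 c xy) (sp_hom1 d yz) /dyck_comp !lift1.
have {}nz : ~ nonvanishing X Z by move/asboolP; rewrite (negPf nz).
rewrite (sp_hom0 _ nz) /dyck_comp /free_lift big1 // => b _.
by rewrite big1 ?scaler0 // => e _; rewrite (sp_hom0 _ nz) scaler0.
Qed.

Lemma dyck_hom_ext X Y (M : lmodType k) (u v : dyck_hom X Y -> M) :
  linear u -> linear v -> (forall c, u (sp_hom c) = v (sp_hom c)) -> u =1 v.
Proof.
by move=> lu lv uv; apply: linear_malg_ext => // b; rewrite sp_hom_val.
Qed.

Lemma dyck_comp_assoc X Y Z T
    (f : dyck_hom X Y) (g : dyck_hom Y Z) (h : dyck_hom Z T) :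
  dyck_comp f (dyck_comp g h) = dyck_comp (dyck_comp f g) h.
Proof.
move: f; apply: dyck_hom_ext => [a x y|a x y|c].
- exact: dyck_comp_linearl.
- by rewrite !dyck_comp_linearl.
move: g; apply: dyck_hom_ext => [a x y|a x y|d].
- by rewrite dyck_comp_linearl dyck_comp_linearr.
- by rewrite dyck_comp_linearr dyck_comp_linearl.
move: h; apply: dyck_hom_ext => [a x y|a x y|e].
- by rewrite !dyck_comp_linearr.
- by rewrite dyck_comp_linearr.
by rewrite !sp_hom_comp -(rprK c) -(rprK d) -(rprK e) !cls_catE sp_catA.
Qed.

Lemma dyck_comp_idl X Y (f : dyck_hom X Y) : dyck_comp (dyck_id X) f = f.
Proof.
move: f; apply: dyck_hom_ext => [||c] //; first exact: dyck_comp_linearr.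
by rewrite sp_hom_comp -(rprK c) cls_catE.
Qed.

Lemma dyck_comp_idr X Y (f : dyck_hom X Y) : dyck_comp f (dyck_id Y) = f.
Proof.
move: f; apply: dyck_hom_ext => [||c] //; first exact: dyck_comp_linearl.
by rewrite sp_hom_comp -(rprK c) cls_catE sp_cat_nil.
Qed.

Definition dyck_lincategory : lincategory k :=
  LinCategory dyck_comp_linearl dyck_comp_linearr
    dyck_comp_assoc dyck_comp_idl dyck_comp_idr.

Definition dyck_category : category := additive_completion dyck_lincategory.

Definition S_sum (X : dyck_category) : Prop :=
  forall a : 'I_(nsummands X), in_S (summand a).

Definition S_category : category := full_subcategory S_sum.

End DyckCategories.

Section Theta.
Variables (k : fieldType) (n : nat) (I J : {set 'I_n.-1}).
Local Notation V := 'I_n.-1.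
Local Notation dyck := (dyck n).
Local Notation spath := (spath I J).

Definition Q_arrow (u v : V) : Prop :=
  (v.+1 = u /\ exists i j : V, seg_ij I J i j /\ (i <= v)%N /\ (u <= j)%N) \/
  (u.+1 = v /\ exists j i : V, seg_ji I J j i /\ (j <= u)%N /\ (v <= i)%N).

Definition Q : quiver := Quiver Q_arrow.

(* The boolean [UD X s] is used as the dimension, 0 or 1, of the space at s of
   the representation attached to X.  In these dimensions [const_mx 1] is the
   identity of k if both spaces are k, and 0 otherwise. *)
Definition theta_step (X : dyck) (F : V * V) (X' : dyck) (s : V) :
    'M[k]_(UD X s, UD X' s) :=
  if (F.1 <= s <= F.2)%N then 0 else const_mx 1.

Fixpoint theta_path X Y (p : spath X Y) (s : V) : 'M[k]_(UD X s, UD Y s) :=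
  match p with
  | sp_nil _ => 1%:M
  | sp_cons X F X' Y _ p' => theta_step X F X' s *m theta_path p' s
  end.

(* [free_lift] extends linearly; independence of the representative chosen by [rpr]
   is [theta_sp_eq] below. *)
Definition theta_hom X Y (f : dyck_hom k I J X Y) (s : V) :
    'M[k]_(UD X s, UD Y s) :=
  free_lift (fun b : hom_basis I J X Y => theta_path (rpr (val b)) s) f.

Definition mx_linfun m m' (A : 'M[k]_(m, m')) : 'Hom('rV[k]_m, 'rV[k]_m') :=
  linfun (mulmxr A).

Local Notation dyck_sum := (formal_sum (dyck_lincategory k I J)).

Definition theta_dim (X : dyck_sum) (s : V) (a : 'I_(nsummands X)) : nat :=
  UD (X a) s.
Arguments theta_dim : clear implicits.

(* Direct sums of representations are realised by row vectors cut into blocks,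
   maps acting by right multiplication. *)
Definition theta_obj (X : dyck_sum) : rep k Q :=
  @Rep k Q (fun s => 'rV[k]_(\sum_a theta_dim X s a))
    (fun u v _ => mx_linfun (\mxblock_(a, b)
       (if a == b then const_mx 1 else 0 : 'M_(theta_dim X u a, theta_dim X v b)))).

Definition theta_mor (X Y : dyck_sum) (f : mx_hom X Y) (s : V) :
    'Hom(theta_obj X s, theta_obj Y s) :=
  mx_linfun (\mxblock_(a, b) theta_hom (f a b) s).

Hypothesis adm : admissible I J.

Definition typ_ij (m : nat) : Prop :=
  exists i j : V, seg_ij I J i j /\ (i < m <= j)%N.
Definition typ_ji (m : nat) : Prop :=
  exists j i : V, seg_ji I J j i /\ (j < m <= i)%N.

Lemma IJ_neq i j : i \in I -> j \in J -> i != j :> nat.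
Proof.
case: adm => dis _ _ _ _ iI jJ; apply/eqP => /val_inj e.
by have := disjointFr dis iI; rewrite e jJ.
Qed.

Lemma typ_excl m : typ_ij m -> typ_ji m -> False.
Proof.
move=> [i [j [[iI jJ [iC jC ij hc]] im]]] [j' [i' [[j'J i'I [j'C i'C ji hc']] jm]]].
have := IJ_neq iI j'J; have := IJ_neq i'I jJ.
by have := hc _ j'C; have := hc _ i'C; have := hc' _ iC; have := hc' _ jC; lia.
Qed.

Lemma seg_ltij i j : seg_ij I J i j -> (i < j)%N.
Proof. by case=> _ _ []. Qed.
Lemma seg_ltji j i : seg_ji I J j i -> (j < i)%N.
Proof. by case=> _ _ []. Qed.

Lemma consecutive_succ c : c \in I :|: J -> ~~ is_last c ->
  exists c', consecutive I J c c'.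
Proof.
case: adm => _ _ _ [_ [z zC zl]] _ cC cl.
have cz : (c < z)%N.
  by move: zl cl; rewrite /is_last; have := ltn_ord c; lia.
case: (@arg_minnP _ z [pred x : V | (x \in I :|: J) && (c < x)%N] val) => /=.
  by rewrite zC.
move=> c' /andP[c'C cc'] hm; exists c'; split=> // x xC.
by have := hm x; rewrite xC /=; lia.
Qed.

Lemma consecutive_pred c : c \in I :|: J -> ~~ is_first c ->
  exists c', consecutive I J c' c.
Proof.
case: adm => _ _ _ [[z zC zl] _] _ cC cl.
have cz : (z < c)%N by move: zl cl; rewrite /is_first; lia.
case: (@arg_maxnP _ z [pred x : V | (x \in I :|: J) && (x < c)%N] val) => /=.
  by rewrite zC.
move=> c' /andP[c'C cc'] hm; exists c'; split=> // x xC.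
by have := hm x; rewrite xC /=; lia.
Qed.

Lemma succ_j j : j \in J -> ~~ is_last j -> exists i, seg_ji I J j i.
Proof.
move=> jJ jl; have [||c cc] := @consecutive_succ j; rewrite ?inE ?jJ ?orbT //.
case: adm => _ _ _ _ h; case: (h _ _ cc) => [[jI]|]; last by exists c.
by have := IJ_neq jI jJ; rewrite eqxx.
Qed.

Lemma pred_j j : j \in J -> ~~ is_first j -> exists i, seg_ij I J i j.
Proof.
move=> jJ jl; have [||c cc] := @consecutive_pred j; rewrite ?inE ?jJ ?orbT //.
case: adm => _ _ _ _ h; case: (h _ _ cc) => [|[_ jI]]; first by exists c.
by have := IJ_neq jI jJ; rewrite eqxx.
Qed.

Section Interval.
Variables (X : dyck) (l r : nat).
Hypotheses (Xlr : UD_interval X l r) (lr : (l < r <= n.-1)%N).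

Lemma UD_itv s : UD X s = (l <= s < r)%N.
Proof. by rewrite /UD Xlr; case: ifP. Qed.
Lemma DU_itv s : DU X s = ~~ (l <= s < r)%N.
Proof. by rewrite /DU Xlr; case: ifP. Qed.

Lemma t_ij_itv i j t : t_ij X i j t ->
  [/\ (i <= t <= j)%N, (l <= t < r)%N & t = maxn i l :> nat].
Proof.
rewrite /t_ij UD_itv => -[h1 h2 h]; split=> //.
have {}h : forall s : V, (i <= s <= j -> l <= s < r -> t <= s)%N.
  by move=> s; rewrite -UD_itv; apply: h.
have bn := ltn_ord j.
have mn : (maxn i l < n.-1)%N by lia.
by have := h (Ordinal mn) => /=; lia.
Qed.

Lemma t_ji_itv j i t : t_ji X j i t ->
  [/\ (j <= t <= i)%N, (l <= t < r)%N & t = minn i r.-1 :> nat].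
Proof.
rewrite /t_ji UD_itv => -[h1 h2 h]; split=> //.
have {}h : forall s : V, (j <= s <= i -> l <= s < r -> s <= t)%N.
  by move=> s; rewrite -UD_itv; apply: h.
have bn := ltn_ord i.
have mn : (minn i r.-1 < n.-1)%N by lia.
by have := h (Ordinal mn) => /=; lia.
Qed.

Lemma p_ij_itv (j t p : V) : (l <= t < r)%N -> p_ij X j t p ->
  (t < p <= j)%N /\ p = r :> nat.
Proof.
rewrite /p_ij DU_itv => ht [h1 h2 h]; split=> //.
have {}h : forall s : V, (t < s <= j -> ~~ (l <= s < r) -> p <= s)%N.
  by move=> s; rewrite -DU_itv; apply: h.
have bn := ltn_ord j.
have mn : (r < n.-1)%N by lia.
by have := h (Ordinal mn) => /=; lia.
Qed.

Lemma p_ji_itv (j t p : V) : (l <= t < r)%N -> p_ji X j t p ->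
  (j <= p < t)%N /\ p.+1 = l.
Proof.
rewrite /p_ji DU_itv => ht [h1 h2 h]; split=> //.
have {}h : forall s : V, (j <= s < t -> ~~ (l <= s < r) -> s <= p)%N.
  by move=> s; rewrite -DU_itv; apply: h.
have bn := ltn_ord t.
have mn : (l.-1 < n.-1)%N by lia.
by have := h (Ordinal mn) => /=; lia.
Qed.

Let itv_range (a b : V) l' r' :
  (forall u : nat, (u < n.-1)%N ->
     (l' <= u < r') = ((a <= u <= b) (+) (l <= u < r)))%N ->
  UD_interval (f_range a b X) l' r'.
Proof.
move=> h u; rewrite block_f_range Xlr h ?ltn_ord //.
by do 2!case: (_ && _).
Qed.

(* From an interval, an elementary shift removes or adds vertices at one end. *)
Variant step_spec (a b : V) (X' : dyck) : Prop :=
| RemoveLeft of (a = l :> nat) & (l <= b < r)%N & UD_interval X' b.+1 r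
    & ((b.+1 < r)%N -> typ_ij b.+1)
| RemoveRight of (b.+1 = r) & (l <= a < r)%N & UD_interval X' l a
    & ((l < a)%N -> typ_ji a)
| AddLeft of (b.+1 = l) & (a <= b)%N & UD_interval X' a r & typ_ji l
| AddRight of (a = r :> nat) & (a <= b)%N & UD_interval X' l b.+1 & typ_ij r.

Lemma shift_itv F X' : shift I J X F X' -> step_spec F.1 F.2 X'.
Proof.
case: F => a b [/= e ->]; case: e.
- move=> i j j' sij h sji [s sj hs] hD; have ij := seg_ltij sij.
  have := h i; have := h j; have := hs s; have := hs i; rewrite !UD_itv => h1 h2 h3 h4.
  have rj : r = j.+1.
    case: (boolP (is_last j)) => [|jl]; first by rewrite /is_last; lia.
    case: (succ_j _ jl) => [|i' sji']; first by case: sij.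
    have ji' := seg_ltji sji'; have jn : (j.+1 < n.-1)%N.
      by have := ltn_ord i'; lia.
    by have := hD _ sji' (Ordinal jn); rewrite DU_itv /=; lia.
  apply: RemoveRight; [lia|lia| |].
    by apply: itv_range => u un; lia.
  by move=> _; exists j', i; split=> //; have := seg_ltji sji; lia.
- move=> j i j' sji h sij [s sj hs] hD; have ij := seg_ltji sji.
  have := h i; have := h j; have := hs s; have := hs i; rewrite !UD_itv => h1 h2 h3 h4.
  have rj : l = j.
    case: (boolP (is_first j)) => [|jl]; first by rewrite /is_first; lia.
    case: (pred_j _ jl) => [|i' sij']; first by case: sji.
    have ji' := seg_ltij sij'; have jn : (j.-1 < n.-1)%N.
      by have := ltn_ord j; lia.
    by have := hD _ sij' (Ordinal jn); rewrite DU_itv /=; lia.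
  apply: RemoveLeft; [lia|lia| |].
    by apply: itv_range => u un; lia.
  by move=> _; exists i, j'; split=> //; have := seg_ltij sij; lia.
- move=> i j t sij /t_ij_itv[h1 h2 h3]; have ij := seg_ltij sij.
  rewrite /is_first /is_last => h4; have tn := ltn_ord t; have jn := ltn_ord j; have inn := ltn_ord i.
  have {}h4 : t = 0 :> nat \/ t.+1 = n.-1 by case/orP: h4 => /eqP; [left|right].
  apply: RemoveLeft; [lia|lia| |].
    by apply: itv_range => u un; lia.
  by move=> tr; exists i, j; split=> //; lia.
- move=> j i t sji /t_ji_itv[h1 h2 h3]; have ij := seg_ltji sji.
  rewrite /is_first /is_last => h4; have tn := ltn_ord t; have jn := ltn_ord j; have inn := ltn_ord i.
  have {}h4 : t = 0 :> nat \/ t.+1 = n.-1 by case/orP: h4 => /eqP; [left|right].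
  apply: RemoveRight; [lia|lia| |].
    by apply: itv_range => u un; lia.
  by move=> tr; exists j, i; split=> //; lia.
- move=> i j t sij /t_ij_itv[h1 h2 h3] h4.
  apply: RemoveLeft; [lia|lia| |].
    by apply: itv_range => u un; lia.
  by move=> tr; exists i, j; split=> //; lia.
- move=> j i t sji /t_ji_itv[h1 h2 h3] h4.
  apply: RemoveRight; [lia|lia| |].
    by apply: itv_range => u un; lia.
  by move=> tr; exists j, i; split=> //; lia.
- move=> i j t i' sij /t_ij_itv[h1 h2 h3] /p_ij_itv[//|h4 h5] sji.
  have ji := seg_ltji sji; apply: AddRight; [lia|lia| |].
    by apply: itv_range => u un; lia.
  by exists i, j; split=> //; lia.
- move=> i j t sij /t_ij_itv[h1 h2 h3] /p_ij_itv[//|h4 h5] _.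
  apply: AddRight; [lia|lia| |].
    by apply: itv_range => u un; lia.
  by exists i, j; split=> //; lia.
- move=> j i t i' sji /t_ji_itv[h1 h2 h3] /p_ji_itv[//|h4 h5] sij.
  have ij := seg_ltij sij; apply: AddLeft; [lia|lia| |].
    by apply: itv_range => u un; lia.
  by exists j, i; split=> //; lia.
- move=> j i t sji /t_ji_itv[h1 h2 h3] /p_ji_itv[//|h4 h5] _.
  apply: AddLeft; [lia|lia| |].
    by apply: itv_range => u un; lia.
  by exists j, i; split=> //; lia.
- move=> i j t p sij /t_ij_itv[h1 h2 h3] /p_ij_itv[//|h4 h5] pj.
  apply: AddRight; [lia|lia| |].
    by apply: itv_range => u un; lia.
  by exists i, j; split=> //; lia.
- move=> j i t p sji /t_ji_itv[h1 h2 h3] /p_ji_itv[//|h4 h5] jp.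
  apply: AddLeft; [lia|lia| |].
    by apply: itv_range => u un; lia.
  by exists j, i; split=> //; lia.
Qed.

End Interval.

Lemma shift_empty X l r F X' : UD_interval X l r -> (r <= l)%N ->
  shift I J X F X' -> False.
Proof.
move=> Xlr rl; have noUD s : UD X s = false.
  by rewrite /UD Xlr; case: ifP => //; lia.
case: F => a b [/= e _]; case: e.
- by move=> i j j' /seg_ltij ij /(_ i); rewrite noUD; lia.
- by move=> j i j' /seg_ltji ij /(_ i); rewrite noUD; lia.
all: intros; match goal with
  | h : t_ij _ _ _ _ |- _ => destruct h as [_ hUD _]
  | h : t_ji _ _ _ _ |- _ => destruct h as [_ hUD _] end;
  by rewrite noUD in hUD.
Qed.

Definition good (X : dyck) : Prop :=
  exists l r, [/\ UD_interval X l r, (l <= n.-1)%N & (r <= n.-1)%N].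

Lemma good_shift X F X' : good X -> shift I J X F X' -> good X'.
Proof.
case: F => a b [l [r [Xlr ln rn]]] sh.
have [rl|lr] := leqP r l; first by case: (shift_empty Xlr rl sh).
have an := ltn_ord a; have bn := ltn_ord b.
have lrn : (l < r <= n.-1)%N by rewrite lr.
case: (shift_itv Xlr lrn sh) => /= h1 h2 h3 _.
- by exists b.+1, r; split=> //; lia.
- by exists l, a; split=> //; lia.
- by exists a, r; split=> //; lia.
- by exists l, b.+1; split=> //; lia.
Qed.

Lemma in_S_good X (s : V) : in_S X -> good X.
Proof.
move=> /in_S_interval[|l [r [lr Xlr]]]; first by have := ltn_ord s; lia.
by exists l, r; split=> //; lia.
Qed.

(* A vertex that has left the support never comes back. *)
Definition dropped (X : dyck) (s : V) : Prop :=
  exists l r, [/\ UD_interval X l r, (l <= n.-1)%N, (r <= n.-1)%N &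
    (l < r)%N -> ((s < l)%N /\ typ_ij l) \/ ((r <= s)%N /\ typ_ji r)].

Lemma dropped_UD X s : dropped X s -> ~~ UD X s.
Proof.
case=> l [r [Xlr _ _ h]]; rewrite (UD_itv Xlr); apply/negP => lsr.
by case: h; lia.
Qed.

Lemma dropped_shift X F X' s : dropped X s -> shift I J X F X' -> dropped X' s.
Proof.
case: F => a b [l [r [Xlr ln rn h]]] sh.
have [rl|lr] := leqP r l; first by case: (shift_empty Xlr rl sh).
have an := ltn_ord a; have bn := ltn_ord b; have {}h := h lr.
have lrn : (l < r <= n.-1)%N by rewrite lr.
case: (shift_itv Xlr lrn sh) => /= h1 h2 h3 h4.
- exists b.+1, r; split=> //; try lia.
  move=> br; case: h => [[sl _]|]; [left|by right].
  by split; [lia|exact: h4].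
- exists l, a; split=> //; try lia.
  move=> br; case: h => [|[sl _]]; [by left|right].
  by split; [lia|exact: h4].
- exists a, r; split=> //; try lia.
  move=> _; case: h => [[_ t]|]; [by case: (typ_excl t h4)|by right].
- exists l, b.+1; split=> //; try lia.
  move=> _; case: h => [|[_ t]]; [by left|by case: (typ_excl h4 t)].
Qed.

Lemma dropped_path X Y (p : spath X Y) s : dropped X s -> ~~ UD Y s.
Proof.
elim: p => [W|W F W' Y' sh p IH] d; first exact: dropped_UD.
by apply: IH; apply: dropped_shift d sh.
Qed.

Lemma drop_shift X F X' s : good X -> shift I J X F X' -> UD X s ->
  ~~ UD X' s -> dropped X' s.
Proof.
case: F => a b [l [r [Xlr ln rn]]] sh.
have [rl|lr] := leqP r l; first by case: (shift_empty Xlr rl sh).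
have an := ltn_ord a; have bn := ltn_ord b.
have lrn : (l < r <= n.-1)%N by rewrite lr.
rewrite (UD_itv Xlr).
case: (shift_itv Xlr lrn sh) => /= h1 h2 h3 h4; rewrite (UD_itv h3) => h5 h6.
- exists b.+1, r; split=> //; try lia.
  by move=> br; left; split; [lia|exact: h4].
- exists l, a; split=> //; try lia.
  by move=> br; right; split; [lia|exact: h4].
- lia.
- lia.
Qed.

Lemma UD_Supp (X : dyck) s : UD X s -> s \in Supp X.
Proof. by move=> /eqP h; rewrite inE h. Qed.

Lemma UD_path X Y (p : spath X Y) s : good X -> UD X s -> UD Y s ->
  s \in common_supp p.
Proof.
elim: p => [W|W F W' Y' sh p IH] gX /=; first by move/UD_Supp.
move=> Xs Ys; rewrite inE UD_Supp //=.
have [W's|W's] := boolP (UD W' s); first by apply: IH => //; apply: good_shift sh.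
by have := dropped_path p (drop_shift gX sh Xs W's); rewrite Ys.
Qed.

Lemma Q_arrowE u v : Q_arrow u v <->
  (v.+1 = u /\ typ_ij u) \/ (u.+1 = v /\ typ_ji v).
Proof.
rewrite /Q_arrow /typ_ij /typ_ji.
by split; (case=> -[e [i [j [h hij]]]]; [left|right]); split=> //;
  exists i, j; split=> //; lia.
Qed.

Lemma const_mul (b1 b2 b3 : bool) :
  (const_mx 1 : 'M[k]_(b1, b2)) *m (const_mx 1 : 'M[k]_(b2, b3)) =
  const_mx b2%:R.
Proof.
apply/matrixP => i j; rewrite !mxE.
by case: b2; rewrite ?big_ord0 // big_ord1 !mxE mulr1.
Qed.

Lemma const_flat (b1 b2 : bool) (x y : k) : (b1 && b2 -> x = y) ->
  const_mx x = const_mx y :> 'M[k]_(b1, b2).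
Proof. by case: b1 b2 => -[] h; apply/matrixP => -[[]] // ? -[[]] // ?; rewrite !mxE h. Qed.

Lemma step_comm X F X' u v : good X -> shift I J X F X' -> Q_arrow u v ->
  (const_mx 1 : 'M_(UD X u, UD X v)) *m theta_step X F X' v =
  theta_step X F X' u *m const_mx 1.
Proof.
case: F => a b [l [r [Xlr ln rn]]] sh /Q_arrowE auv; rewrite /theta_step /=.
have [rl|lr] := leqP r l; first by case: (shift_empty Xlr rl sh).
have lrn : (l < r <= n.-1)%N by rewrite lr.
have XE := UD_itv Xlr.
have un := ltn_ord u; have vn := ltn_ord v.
have zE (b1 b2 : bool) : (0 : 'M[k]_(b1, b2)) = const_mx 0 by [].
case: ifP => Fv; case: ifP => Fu; rewrite ?mulmx0 ?mul0mx ?const_mul // ?zE.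
- apply: const_flat => /andP[Xu X'v]; exfalso; move: Xu X'v; rewrite XE.
  case: (shift_itv Xlr lrn sh) => /= h1 h2 h3 h4; rewrite (UD_itv h3) => h5 h6;
    case: auv => -[e t]; try lia.
  + have e' : u = l :> nat by lia.
    by rewrite e' in t; exact: typ_excl t h4.
  + have e' : v = r :> nat by lia.
    by rewrite e' in t; exact: typ_excl h4 t.
- apply: const_flat => /andP[Xu X'v].
  have [Xv|//] := boolP (UD X v); exfalso; move: Xu X'v Xv; rewrite !XE.
  case: (shift_itv Xlr lrn sh) => /= h1 h2 h3 h4; rewrite (UD_itv h3) => h5 h6 h7;
    case: auv => -[e t]; try lia.
  + have e' : v = b.+1 :> nat by lia.
    by rewrite e' in t; apply: typ_excl (h4 _) t; lia.
  + have e' : u = a :> nat by lia.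
    by rewrite e' in t; apply: typ_excl t (h4 _); lia.
- have E (s : V) : (a <= s <= b)%N = false -> UD X' s = UD X s.
    by case: sh => _ -> /=; rewrite /UD block_f_range => ->.
  by apply: const_flat; rewrite !E // => /andP[-> ->].
Qed.

Lemma path_comm X Y (p : spath X Y) u v : good X -> Q_arrow u v ->
  (const_mx 1 : 'M_(UD X u, UD X v)) *m theta_path p v =
  theta_path p u *m const_mx 1.
Proof.
move=> + auv; elim: p => [W|W F W' Y' sh p IH] gX /=.
  by rewrite mulmx1 mul1mx.
rewrite mulmxA (step_comm gX sh auv) -!mulmxA IH //.
exact: good_shift gX sh.
Qed.

Lemma theta_cat X Y Z (p : spath X Y) (q : spath Y Z) s :
  theta_path (sp_cat p q) s = theta_path p s *m theta_path q s.
Proof.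
elim: p q => [W|W F W' Y' sh p IH] q /=; first by rewrite mul1mx.
by rewrite IH mulmxA.
Qed.

Lemma shift_UD X F X' (s : V) : shift I J X F X' -> (F.1 <= s <= F.2)%N = false ->
  UD X' s = UD X s.
Proof. by case=> _ -> Fs; rewrite /UD block_f_range Fs. Qed.

Lemma theta_sp_eq X Y (p q : spath X Y) s : sp_eq p q ->
  theta_path p s = theta_path q s.
Proof.
elim=> {X Y p q} [X X' X'' Y F G a b c d _|X Y Z p p' q q' _ h1 _ h2|||] //.
- rewrite /= !mulmx1 /theta_step.
  case: ifP => Fs; case: ifP => Gs; rewrite ?mulmx0 ?mul0mx // !const_mul.
  by apply: const_flat; rewrite (shift_UD a Fs) (shift_UD c Gs).
- by rewrite !theta_cat h1 h2.
- by move=> X Y p q r _ -> _ ->.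
Qed.

Lemma theta_hom_linear X Y s : linear (fun f : dyck_hom k I J X Y => theta_hom f s).
Proof. exact: lift_linear. Qed.

Lemma theta_hom_cls X Y (p : spath X Y) s : nonvanishing I J X Y ->
  theta_hom (sp_hom k (cls p)) s = theta_path p s.
Proof.
move=> /asboolP nz; rewrite (sp_hom1 _ _ nz) /theta_hom lift1 /=.
by apply: theta_sp_eq; apply: rpr_cls.
Qed.

Lemma theta_hom_id X s : good X -> theta_hom (dyck_id k I J X) s = 1%:M.
Proof.
move=> gX; have [/asboolP nz|/asboolPn nz] := boolP `[< nonvanishing I J X X >].
  exact: theta_hom_cls.
rewrite /dyck_id sp_hom0 // -[LHS]/(free_lift _ _) /free_lift msupp0 big_nil.
have [Xs|Xs] := boolP (UD X s); last first.
  by apply/matrixP => -[i]; case: (UD X s) Xs.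
case: nz => p; apply/set0Pn; exists s; exact: UD_path.
Qed.

Lemma theta_hom_comp X Y Z (f : dyck_hom k I J X Y) (g : dyck_hom k I J Y Z) s :
  good X -> theta_hom (dyck_comp f g) s = theta_hom f s *m theta_hom g s.
Proof.
move=> gX; move: f; apply: dyck_hom_ext => [a x y|a x y|c].
- by rewrite dyck_comp_linearl theta_hom_linear.
- by rewrite theta_hom_linear mulmxDl scalemxAl.
move: g; apply: dyck_hom_ext => [a x y|a x y|d].
- by rewrite dyck_comp_linearr theta_hom_linear.
- by rewrite theta_hom_linear mulmxDr scalemxAr.
rewrite sp_hom_comp -(rprK c) -(rprK d) cls_catE.
have [/asboolP nz|/asboolPn nz] := boolP `[< nonvanishing I J X Z >].
  have [xy yz] := nonvanishingW nz (rpr c) (rpr d).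
  by rewrite !theta_hom_cls // theta_cat.
have XZ : ~~ (UD X s && UD Z s).
  apply/negP => /andP[Xs Zs]; case: nz => p; apply/set0Pn; exists s.
  exact: UD_path.
apply/matrixP => i j; exfalso; case: i j XZ => i + [j].
by case: (UD X s) (UD Z s) => -[].
Qed.

Lemma theta_hom_comm X Y (f : dyck_hom k I J X Y) u v : good X -> Q_arrow u v ->
  (const_mx 1 : 'M_(UD X u, UD X v)) *m theta_hom f v =
  theta_hom f u *m const_mx 1.
Proof.
move=> gX auv; move: f; apply: dyck_hom_ext => [a x y|a x y|c].
- by rewrite theta_hom_linear mulmxDr scalemxAr.
- by rewrite theta_hom_linear mulmxDl scalemxAl.
rewrite -(rprK c).
have [/asboolP nz|/asboolPn nz] := boolP `[< nonvanishing I J X Y >].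
  by rewrite !theta_hom_cls // path_comm.
by rewrite sp_hom0 // /theta_hom /free_lift msupp0 !big_nil mulmx0 mul0mx.
Qed.

Lemma mx_linfun_comp m m' m'' (A : 'M[k]_(m, m')) (B : 'M[k]_(m', m'')) :
  (mx_linfun B \o mx_linfun A)%VF = mx_linfun (A *m B).
Proof. by apply/lfunP => x; rewrite comp_lfunE !lfunE /= mulmxA. Qed.

Lemma mx_linfun1 m : mx_linfun (1%:M : 'M[k]_m) = \1%VF.
Proof. by apply/lfunP => x; rewrite !lfunE /= mulmx1. Qed.

Local Notation C := (S_category k I J).

Lemma S_good (X : C) (a : 'I_(nsummands (sval X))) (s : V) : good (sval X a).
Proof. exact: in_S_good s (svalP X a). Qed.

Lemma theta_mor_comm (X Y : C) (f : hom X Y) u v (a : arrow (q := Q) u v) :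
  (theta_mor f v \o rep_map (theta_obj (sval X)) a =
   rep_map (theta_obj (sval Y)) a \o theta_mor f u)%VF.
Proof.
rewrite /= !mx_linfun_comp !mul_mxblock; congr mx_linfun.
apply: eq_mxblock => i j.
rewrite (bigD1 i) //= eqxx big1 ?addr0; last first.
  by move=> i' /negPf; rewrite eq_sym => ->; rewrite mul0mx.
rewrite (bigD1 j) //= eqxx big1 ?addr0; last first.
  by move=> i' /negPf ->; rewrite mulmx0.
by apply: theta_hom_comm => //; exact: (S_good i u).
Qed.

Definition theta_rep_mor (X Y : C) (f : hom X Y) :
    rep_hom (theta_obj (sval X)) (theta_obj (sval Y)) :=
  RepHom (theta_mor_comm f).

Lemma theta_id (X : C) :
  theta_rep_mor (idm X) = idm (theta_obj (sval X) : rep_category k Q).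
Proof.
apply: rep_hom_eq => s /=; rewrite /theta_mor -mx_linfun1; congr mx_linfun.
rewrite -mxdiagZ /mxdiag; apply: eq_mxblock => i j.
case: eqVneq => [<-|ij].
  by rewrite conform_mx_id mx_idii theta_hom_id //; exact: (S_good i s).
by rewrite mx_id_neq // /theta_hom /free_lift msupp0 big_nil.
Qed.

Lemma theta_comp (X Y Z : C) (f : hom X Y) (g : hom Y Z) :
  theta_rep_mor (hcomp f g) =
  hcomp (c := rep_category k Q) (theta_rep_mor f) (theta_rep_mor g).
Proof.
apply: rep_hom_eq => s /=; rewrite mx_linfun_comp mul_mxblock.
congr mx_linfun; apply: eq_mxblock => i l.
rewrite /mx_comp; pose h j := lcomp (f i j) (g j l).
rewrite -[LHS]/(theta_hom (\sum_j h j) s).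
have -> : theta_hom (\sum_j h j) s = \sum_j theta_hom (h j) s.
  apply: (big_morph (fun f => theta_hom f s)) => [x y|].
    by rewrite -[x]scale1r theta_hom_linear !scale1r.
  by rewrite /theta_hom /free_lift msupp0 big_nil.
by apply: eq_bigr => j _; rewrite theta_hom_comp //; exact: (S_good i s).
Qed.

Definition Theta : functor C (rep_category k Q) :=
  @Functor C (rep_category k Q) (fun X => theta_obj (sval X)) theta_rep_mor
    theta_id theta_comp.

End Theta.

(* Main.v *)
From HB Require Import structures.
From mathcomp Require Import all_boot all_algebra.
From mathcomp Require Import finmap boolp zify.
From mathcomp.multinomials Require Import monalg.
Require Import Defs.

Set Implicit Arguments.
Unset Strict Implicit.
Unset Printing Implicit Defensive.

Import GRing.Theory.
Local Open Scope ring_scope.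

(** Theta is fully faithful and essentially surjective.

    A Dyck path of S is an interval [l, r) of vertices, 0 <= l < r <= n - 1,
    and Theta sends it to the interval representation on [l, r).

    A shift that starts at an interval and does not empty it moves one end only.
    The next value of the left end depends on the left end alone: it runs down
    through the [x] with an arrow [x-1 -> x], then to 0, then up through the [x]
    with an arrow [x -> x-1] ([lnext], [shift_end_step], [left_move]).
    Right ends behave symmetrically.  The functions [lkey] and [rkey] number the
    ends in these orders.  So a shift path between two intervals that meet is a
    lattice path in a grid, steps in the two directions commute, and all such
    paths are identified ([path_unique]); and a path exists as soon as neither end
    has to move back ([path_exists]).  On the side of representations, a
    nonzero morphism between interval representations is a scalar on the common
    vertices, and the arrows across the two ends of the intersection say exactly
    that neither end moves back.  Hence Theta is bijective on morphisms between
    intervals ([theta_hom_inj], [theta_hom_surj]), and then on matrices of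
    morphisms.

    Essential surjectivity is the decomposition of representations of a quiver
    of type A into intervals ([interval_basis_exists]), obtained by adding the
    vertices one at a time.  The generators alive at the last vertex are totally
    preordered by the [lkey] of their left ends, and a generator may be modified
    by those that do not come before it ([interval_basis_replace]).  This makes any given
    subspace of the last space a span of generators ([interval_basis_adapt]).
    Applied to the kernel or the image of the new arrow, it lets the
    decomposition be extended ([interval_basis_step]). *)

(** * Fully faithful and essentially surjective functors *)

Section Equivalence.
Variables (C E : category) (F : functor C E).

(** Injectivity on every hom-set. *)
Definition faithful_functor : Prop :=
  forall (X Y : C) (f g : hom X Y), fmor F f = fmor F g -> f = g.

(** Surjectivity on every hom-set. *)
Definition full_functor : Prop :=
  forall (X Y : C) (h : hom (F X) (F Y)), exists f, fmor F f = h.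

(** Every object of the target is isomorphic to a value of the functor. *)
Definition essentially_surjective : Prop :=
  forall Z : E, exists X : C, exists f : hom (F X) Z, is_iso f.

Lemma equivalence_of_fully_faithful :
  faithful_functor -> full_functor -> essentially_surjective ->
  is_equivalence F.
Proof.
move=> faith full ess.
pose G0 Z : C := projT1 (cid (ess Z)).
have [eps epsP] : {eps : forall Z, hom (F (G0 Z)) Z & forall Z, is_iso (eps Z)}.
  exists (fun Z => projT1 (cid (projT2 (cid (ess Z))))) => Z.
  exact: projT2 (cid (projT2 (cid (ess Z)))).
pose eps' Z : hom Z (F (G0 Z)) := projT1 (cid (epsP Z)).
have e1 Z : hcomp (eps Z) (eps' Z) = idm _ by case: (projT2 (cid (epsP Z))).
have e2 Z : hcomp (eps' Z) (eps Z) = idm _ by case: (projT2 (cid (epsP Z))).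
pose lift X Y (h : hom (F X) (F Y)) : hom X Y := projT1 (cid (full X Y h)).
have liftK X Y (h : hom (F X) (F Y)) : fmor F (lift _ _ h) = h.
  exact: projT2 (cid (full X Y h)).
pose G1 Z W (h : hom Z W) : hom (G0 Z) (G0 W) :=
  lift _ _ (hcomp (hcomp (eps Z) h) (eps' W)).
have G1id Z : G1 _ _ (idm Z) = idm _.
  by apply: faith; rewrite liftK comp_idr e1 fmor_id.
have G1comp X Y Z (f : hom X Y) (g : hom Y Z) :
    G1 _ _ (hcomp f g) = hcomp (G1 _ _ f) (G1 _ _ g).
  apply: faith; rewrite fmor_comp !liftK -!comp_assoc.
  by rewrite [hcomp (eps' Y) _]comp_assoc e2 comp_idl.
exists (Functor G1id G1comp); split.
  exists (fun X => lift _ _ (eps (F X))); split.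
    move=> X; exists (lift _ _ (eps' (F X))).
    by split; apply: faith; rewrite fmor_comp !liftK fmor_id ?e1 ?e2.
  move=> X Y f; apply: faith.
  by rewrite !fmor_comp /= !liftK -!comp_assoc e2 comp_idr.
exists eps; split=> // X Y f /=.
by rewrite liftK -!comp_assoc e2 comp_idr.
Qed.

End Equivalence.

(** * Orientation of the quiver and the order on the ends of intervals *)

Section Chain.
Variables (n : nat) (I J : {set 'I_n.-1}).
Hypothesis adm : admissible I J.
Local Open Scope nat_scope.
Local Notation V := 'I_n.-1.
(* [ij m] holds when the arrow is m -> m-1, [ji m] when it is m-1 -> m. *)
Local Notation ij := (typ_ij I J).
Local Notation ji := (typ_ji I J).

Lemma seg_ij_typ (i j : V) x : seg_ij I J i j -> i < x <= j -> ij x.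
Proof. by move=> sij hx; exists i, j. Qed.

Lemma seg_ji_typ (j i : V) x : seg_ji I J j i -> j < x <= i -> ji x.
Proof. by move=> sji hx; exists j, i. Qed.

Lemma typ_ij_lt m : ij m -> 0 < m < n.-1.
Proof. by case=> i [j [_ h]]; have := ltn_ord j; lia. Qed.

Lemma typ_ji_lt m : ji m -> 0 < m < n.-1.
Proof. by case=> j [i [_ h]]; have := ltn_ord i; lia. Qed.

Lemma typ_total m : 0 < m < n.-1 -> ij m \/ ji m.
Proof.
case: adm => _ _ _ [[z zC /eqP z0] _] alt hm.
case: (@arg_maxnP _ z [pred x : V | (x \in I :|: J) && (x < m)] val) => /=.
  by rewrite zC z0; lia.
move=> c /andP[cC cm] cmax.
have [||c' cc'] := @consecutive_succ _ I J adm c => //.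
  by rewrite /is_last; lia.
have mc' : m <= c'.
  case: cc' => _ c'C lt _; have := cmax c'; rewrite c'C /=; lia.
by case: (alt _ _ cc') => s; [left|right]; exists c, c'; split=> //; lia.
Qed.

Lemma typ_jiN m : 0 < m < n.-1 -> ~ ij m -> ji m.
Proof. by move/typ_total => []. Qed.

Lemma typ_ijN m : 0 < m < n.-1 -> ~ ji m -> ij m.
Proof. by move/typ_total => []. Qed.

(** The elements of [I] are sinks and those of [J] are sources. *)
Lemma typ_at_sink (i : V) : i \in I -> ~ ij i /\ ~ ji i.+1.
Proof.
move=> iI; have iC : i \in I :|: J by rewrite inE iI.
split; case=> a [b []] [aX bX [aC bC ab hab]] iab.
  have bi := IJ_neq adm iI bX.
  by have := hab _ iC; lia.
have ai := IJ_neq adm iI aX.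
by have := hab _ iC; lia.
Qed.

Lemma typ_at_source (j : V) : j \in J -> ~ ji j /\ ~ ij j.+1.
Proof.
move=> jJ; have jC : j \in I :|: J by rewrite inE jJ orbT.
split; case=> a [b []] [aX bX [aC bC ab hab]] jab.
  have bj := IJ_neq adm bX jJ.
  by have := hab _ jC; lia.
have aj := IJ_neq adm aX jJ.
by have := hab _ jC; lia.
Qed.

Lemma succ_i i : i \in I -> ~~ is_last i -> exists j, seg_ij I J i j.
Proof.
move=> iI il; have [||c cc] := @consecutive_succ _ I J adm i; rewrite ?inE ?iI //.
case: adm => _ _ _ _ h; case: (h _ _ cc) => [|[jJ]]; first by exists c.
by have := IJ_neq adm iI jJ; rewrite eqxx.
Qed.

Lemma pred_i i : i \in I -> ~~ is_first i -> exists j, seg_ji I J j i.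
Proof.
move=> iI il; have [||c cc] := @consecutive_pred _ I J adm i; rewrite ?inE ?iI //.
case: adm => _ _ _ _ h; case: (h _ _ cc) => [[_ jJ]|]; last by exists c.
by have := IJ_neq adm iI jJ; rewrite eqxx.
Qed.

(** [lnext l m]: the left end that follows [l] is [m].  Left ends run down
    through the [x] with [ji x], then to 0, which is of neither type, then up
    through the [x] with [ij x]. *)
Definition lnext l m : Prop :=
  [/\ ji l, m < l, ~ ij m & forall x, m < x < l -> ij x] \/
  [/\ ~ ji l, l < m, ij m & forall x, l < x < m -> ji x].

(** The same for right ends, [r] being the right end of [l, r).  They run up
    through the [x] with [ij x], then to [n.-1], which is of neither type, then
    down through the [x] with [ji x]. *)
Definition rnext r m : Prop :=
  [/\ ij r, r < m <= n.-1, ~ ji m & forall x, r < x < m -> ji x] \/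
  [/\ ~ ij r, m < r, ji m & forall x, m < x < r -> ij x].

Lemma lnext_fun l m m' : lnext l m -> lnext l m' -> m = m'.
Proof.
case=> -[h1 h2 h3 h4] [[h1' h2' h3' h4']|[h1' h2' h3' h4']] //;
  case: (ltngtP m m') => // lt; exfalso.
- by apply: h3'; apply: h4; lia.
- by apply: h3; apply: h4'; lia.
- by apply: (typ_excl adm h3); apply: h4'; lia.
- by apply: (typ_excl adm h3'); apply: h4; lia.
Qed.

Lemma rnext_fun r m m' : rnext r m -> rnext r m' -> m = m'.
Proof.
case=> -[h1 h2 h3 h4] [[h1' h2' h3' h4']|[h1' h2' h3' h4']] //;
  case: (ltngtP m m') => // lt; exfalso.
- by apply: h3; apply: h4'; lia.
- by apply: h3'; apply: h4; lia.
- by apply: (typ_excl adm _ h3'); apply: h4; lia.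
- by apply: (typ_excl adm _ h3); apply: h4'; lia.
Qed.

(** Numberings of the left ends, in 0, ..., n-2, and of the right ends, in
    1, ..., n-1, that increase along [lnext] and [rnext]. *)
Definition lkey l : nat := if `[< ji l >] then n.-1 - l else n.-1 + l.
Definition rkey r : nat := if `[< ij r >] then r else (n.-1).*2 - r.

Lemma lkey_ji l : ji l -> lkey l = n.-1 - l.
Proof. by rewrite /lkey => /asboolP ->. Qed.
Lemma lkeyN l : ~ ji l -> lkey l = n.-1 + l.
Proof. by move=> h; rewrite /lkey asboolF. Qed.
Lemma rkey_ij r : ij r -> rkey r = r.
Proof. by rewrite /rkey => /asboolP ->. Qed.
Lemma rkeyN r : ~ ij r -> rkey r = (n.-1).*2 - r.
Proof. by move=> h; rewrite /rkey asboolF. Qed.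

(** Case analysis on the number of a left end, and below of a right end. *)
Variant lkey_spec l : nat -> Prop :=
| LkeyJi of ji l & 0 < l < n.-1 & ~ ij l : lkey_spec l (n.-1 - l)
| LkeyN of ~ ji l & (0 < l < n.-1 -> ij l) : lkey_spec l (n.-1 + l).

Lemma lkeyP l : lkey_spec l (lkey l).
Proof.
have [h|h] := EM (ji l).
  rewrite lkey_ji //; apply: LkeyJi => //; first exact: typ_ji_lt.
  by move=> h'; exact: typ_excl adm _ h' h.
by rewrite lkeyN //; apply: LkeyN => // hl; exact: typ_ijN.
Qed.

Variant rkey_spec r : nat -> Prop :=
| RkeyIj of ij r & 0 < r < n.-1 & ~ ji r : rkey_spec r r
| RkeyN of ~ ij r & (0 < r < n.-1 -> ji r) : rkey_spec r ((n.-1).*2 - r).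

Lemma rkeyP r : rkey_spec r (rkey r).
Proof.
have [h|h] := EM (ij r).
  rewrite rkey_ij //; apply: RkeyIj => //; first exact: typ_ij_lt.
  by move=> h'; exact: typ_excl adm _ h h'.
by rewrite rkeyN //; apply: RkeyN => // hl; exact: typ_jiN.
Qed.

Lemma lnext_lt l m : l < n.-1 -> lnext l m -> m < n.-1 /\ lkey l < lkey m.
Proof.
move=> ln [[h1 h2 h3 _]|[h1 h2 h3 _]].
  by rewrite lkey_ji //; case: (lkeyP m); lia.
by rewrite (lkeyN h1); have := typ_ij_lt h3; case: (lkeyP m) => //; lia.
Qed.

Lemma rnext_lt r m : 0 < r <= n.-1 -> rnext r m ->
  0 < m <= n.-1 /\ rkey r < rkey m.
Proof.
move=> ln [[h1 h2 h3 _]|[h1 h2 h3 _]].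
  by have := typ_ij_lt h1; rewrite rkey_ij //; case: (rkeyP m); lia.
by rewrite (rkeyN h1); have := typ_ji_lt h3; case: (rkeyP m) => //; lia.
Qed.

(** In the order of left ends, none lies strictly between [l] and its successor. *)
Lemma lnext_le l m l' : l < n.-1 -> l' < n.-1 -> lnext l m ->
  lkey l < lkey l' -> lkey m <= lkey l'.
Proof.
move=> ln l'n [[h1 h2 h3 h4]|[h1 h2 h3 h4]].
  have ln' := typ_ji_lt h1; have h5 := h4 l'.
  have [m0|jm] : m = 0 \/ ji m.
    by case: (posnP m) => m0; [left|right; apply: typ_jiN => //; lia].
    rewrite (lkey_ji h1) (@lkeyN m); last first.
      by move/typ_ji_lt; lia.
    case: (lkeyP l') => [l1 l2 l3|*]; last by lia.
    move=> lt; have : ~~ (m < l' < l) by apply/negP => /h5.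
    by lia.
  rewrite (lkey_ji h1) (lkey_ji jm); case: (lkeyP l') => [l1 l2 l3|*]; last by lia.
  move=> lt; have : ~~ (m < l' < l) by apply/negP => /h5.
  by lia.
rewrite (lkeyN h1) (lkeyN (fun h => typ_excl adm h3 h)).
have h5 := h4 l'; case: (lkeyP l') => [l1 l2 l3|l1 l2]; first by lia.
move=> lt; have : ~~ (l < l' < m) by apply/negP => /h5.
by lia.
Qed.

Lemma rnext_le r m r' : 0 < r <= n.-1 -> 0 < r' <= n.-1 -> rnext r m ->
  rkey r < rkey r' -> rkey m <= rkey r'.
Proof.
move=> rn r'n [[h1 h2 h3 h4]|[h1 h2 h3 h4]].
  have rn' := typ_ij_lt h1; have h5 := h4 r'.
  have [mN|im] : m = n.-1 \/ ij m.
    by case: (ltnP m n.-1) => m0; [right; apply: typ_ijN => //; lia|left; lia].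
    rewrite (rkey_ij h1) (@rkeyN m); last first.
      by move/typ_ij_lt; lia.
    case: (rkeyP r') => [l1 l2 l3|*]; last by lia.
    move=> lt; have : ~~ (r < r' < m) by apply/negP => /h5.
    by lia.
  rewrite (rkey_ij h1) (rkey_ij im); case: (rkeyP r') => [l1 l2 l3|*]; last by lia.
  move=> lt; have : ~~ (r < r' < m) by apply/negP => /h5.
  by lia.
rewrite (rkeyN h1) (rkeyN (fun h => typ_excl adm h h3)).
have h5 := h4 r'; case: (rkeyP r') => [l1 l2 l3|l1 l2]; first by lia.
move=> lt; have : ~~ (m < r' < r) by apply/negP => /h5.
by lia.
Qed.

(** Left ends passed on the way from [l] to [l'] do not exceed both. *)
Lemma lkey_between l m l' : l < n.-1 -> m < n.-1 -> l' < n.-1 ->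
  lkey l <= lkey m <= lkey l' -> m <= maxn l l'.
Proof. by move=> ln mn l'n; case: (lkeyP l); case: (lkeyP m); case: (lkeyP l'); lia. Qed.

Lemma rkey_between r m r' : r <= n.-1 -> m <= n.-1 -> r' <= n.-1 ->
  rkey r <= rkey m <= rkey r' -> minn r r' <= m.
Proof. by move=> rn mn r'n; case: (rkeyP r); case: (rkeyP m); case: (rkeyP r'); lia. Qed.

Lemma lkey_inj l l' : l < n.-1 -> l' < n.-1 -> lkey l = lkey l' -> l = l'.
Proof. by move=> ln l'n; case: (lkeyP l); case: (lkeyP l'); lia. Qed.

Lemma rkey_inj r r' : 0 < r <= n.-1 -> 0 < r' <= n.-1 -> rkey r = rkey r' -> r = r'.
Proof. by move=> ln l'n; case: (rkeyP r); case: (rkeyP r'); lia. Qed.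

End Chain.

(** * Elementary shifts of intervals *)

Section Steps.
Variables (n : nat) (I J : {set 'I_n.-1}).
Hypothesis adm : admissible I J.
Local Open Scope nat_scope.
Local Notation V := 'I_n.-1.
Local Notation dyck := (dyck n).
Local Notation ij := (typ_ij I J).
Local Notation ji := (typ_ji I J).
Local Notation lnext := (lnext I J).
Local Notation rnext := (rnext I J).

(** [move_label x m F]: [F] labels the shift that moves one end of an interval
    from [x] to [m]; it flips the blocks between [x] and [m], and so does not
    depend on the other end. *)
Definition move_label x m (F : V * V) : Prop :=
  F.1 = minn x m :> nat /\ F.2.+1 = maxn x m.

Lemma move_label_inj x m F G : move_label x m F -> move_label x m G -> F = G.
Proof.
case: F G => a b [c d] [/= h1 h2] [/= h3 h4].
by congr (_, _); apply: val_inj => /=; lia.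
Qed.

Section OneStep.
Variables (X : dyck) (l r : nat).
Hypotheses (Xlr : UD_interval X l r) (lr : l < r <= n.-1).

(** What a shift [F] can do to the interval [l, r): move its left end, move its
    right end, or empty it. *)
Variant end_step (F : V * V) (X' : dyck) : Prop :=
| StepLeft m of lnext l m & m < r & UD_interval X' m r & move_label l m F
| StepRight m of rnext r m & l < m & UD_interval X' l m & move_label r m F
| StepEmpty of forall s, ~~ UD X' s.

Lemma f_range_itv (a b : V) l' r' :
  (forall u : nat, u < n.-1 -> (l' <= u < r') = ((a <= u <= b) (+) (l <= u < r))) ->
  UD_interval (f_range a b X) l' r'.
Proof.
move=> h u; rewrite block_f_range Xlr h ?ltn_ord //.
by do 2!case: (_ && _).
Qed.

Let empty_itv (Y : dyck) l' r' : r' <= l' -> UD_interval Y l' r' ->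
  forall s, ~~ UD Y s.
Proof. by move=> h Y0 s; rewrite (UD_itv Y0); lia. Qed.

Let remove_left (a b : V) : a = l :> nat -> l <= b < r ->
  (b.+1 < r -> lnext l b.+1) -> end_step (a, b) (f_range a b X).
Proof.
move=> al lbr h; have X' : UD_interval (f_range a b X) b.+1 r.
  by apply: f_range_itv => u un; lia.
have [br|br] := ltnP b.+1 r; last by apply: StepEmpty; exact: empty_itv X'.
by apply: (StepLeft _ br) => //; [exact: h|split=> /=; lia].
Qed.

Let remove_right (a b : V) : b.+1 = r -> l <= a < r ->
  (l < a -> rnext r a) -> end_step (a, b) (f_range a b X).
Proof.
move=> al lbr h; have X' : UD_interval (f_range a b X) l a.
  by apply: f_range_itv => u un; lia.
have [br|br] := ltnP l a; last by apply: StepEmpty; exact: empty_itv X'.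
by apply: (StepRight _ br) => //; [exact: h|split=> /=; lia].
Qed.

Let add_left (a b : V) : b.+1 = l -> a <= b -> lnext l a ->
  end_step (a, b) (f_range a b X).
Proof.
move=> bl ab h; apply: (StepLeft h); first by lia.
  by apply: f_range_itv => u un; lia.
by split=> /=; lia.
Qed.

Let add_right (a b : V) : a = r :> nat -> a <= b -> rnext r b.+1 ->
  end_step (a, b) (f_range a b X).
Proof.
move=> bl ab h; apply: (StepRight h); first by lia.
  by apply: f_range_itv => u un; lia.
by split=> /=; lia.
Qed.

Lemma shift_end_step F X' : shift I J X F X' -> end_step F X'.
Proof.
case: F => a b [/= e ->]; case: e.
- move=> i j j' sij h sji [s sj hs] hD; have lij := seg_ltij sij.
  have := h i; have := h j; have := hs s; have := hs i; rewrite !(UD_itv Xlr) => h1 h2 h3 h4.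
  have rj : r = j.+1.
    case: (boolP (is_last j)) => [|jl]; first by rewrite /is_last; lia.
    case: (succ_j adm _ jl) => [|i' sji']; first by case: sij.
    have ji' := seg_ltji sji'; have jn : j.+1 < n.-1 by have := ltn_ord i'; lia.
    by have := hD _ sji' (Ordinal jn); rewrite (DU_itv Xlr) /=; lia.
  apply: remove_right; [lia|lia|move=> _; right; split].
  + by rewrite rj; apply: (typ_at_source adm _).2; case: sij.
  + by lia.
  + by apply: (seg_ji_typ sji); have := seg_ltji sji; lia.
  + by move=> x hx; apply: (seg_ij_typ sij); lia.
- move=> j i j' sji h sij [s sj hs] hD; have lji := seg_ltji sji.
  have := h i; have := h j; have := hs s; have := hs i; rewrite !(UD_itv Xlr) => h1 h2 h3 h4.
  have rj : l = j.
    case: (boolP (is_first j)) => [|jl]; first by rewrite /is_first; lia.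
    case: (pred_j adm _ jl) => [|i' sij']; first by case: sji.
    have ji' := seg_ltij sij'; have jn : j.-1 < n.-1 by have := ltn_ord j; lia.
    by have := hD _ sij' (Ordinal jn); rewrite (DU_itv Xlr) /=; lia.
  apply: remove_left; [lia|lia|move=> _; right; split].
  + by rewrite rj; apply: (typ_at_source adm _).1; case: sji.
  + by lia.
  + by apply: (seg_ij_typ sij); have := seg_ltij sij; lia.
  + by move=> x hx; apply: (seg_ji_typ sji); lia.
- move=> i j t sij /(t_ij_itv Xlr lr)[h1 h2 h3]; have lij := seg_ltij sij.
  rewrite /is_first /is_last => h4; have tn := ltn_ord t; have jn := ltn_ord j; have inn := ltn_ord i.
  have {}h4 : t = 0 :> nat \/ t.+1 = n.-1 by case/orP: h4 => /eqP; [left|right].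
  apply: remove_left; [lia|lia|move=> tr; right; split].
  + by move=> /typ_ji_lt; lia.
  + by lia.
  + by apply: (seg_ij_typ sij); lia.
  + by move=> x; lia.
- move=> j i t sji /(t_ji_itv Xlr lr)[h1 h2 h3]; have lji := seg_ltji sji.
  rewrite /is_first /is_last => h4; have tn := ltn_ord t; have jn := ltn_ord j; have inn := ltn_ord i.
  have {}h4 : t = 0 :> nat \/ t.+1 = n.-1 by case/orP: h4 => /eqP; [left|right].
  apply: remove_right; [lia|lia|move=> tr; right; split].
  + by move=> /typ_ij_lt; lia.
  + by lia.
  + by apply: (seg_ji_typ sji); lia.
  + by move=> x; lia.
- move=> i j t sij /(t_ij_itv Xlr lr)[h1 h2 h3] h4.
  have tij x : i < x <= j -> ij x by exact: seg_ij_typ.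
  apply: remove_left; [lia|lia|move=> tr; right; split].
  + by move=> hji; apply: (typ_excl adm _ hji); apply: tij; lia.
  + by lia.
  + by apply: tij; lia.
  + by move=> x; lia.
- move=> j i t sji /(t_ji_itv Xlr lr)[h1 h2 h3] h4.
  have tji x : j < x <= i -> ji x by exact: seg_ji_typ.
  apply: remove_right; [lia|lia|move=> tr; right; split].
  + by move=> hij; apply: (typ_excl adm hij); apply: tji; lia.
  + by lia.
  + by apply: tji; lia.
  + by move=> x; lia.
- move=> i j t i' sij /(t_ij_itv Xlr lr)[h1 h2 h3] /(p_ij_itv Xlr lr h2)[h4 h5] sji.
  have lji := seg_ltji sji; have := ltn_ord i' => i'n.
  apply: add_right; [lia|lia|left; split].
  + by apply: (seg_ij_typ sij); lia.
  + by lia.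
  + by apply: (typ_at_sink adm _).2; case: sji.
  + by move=> x hx; apply: (seg_ji_typ sji); lia.
- move=> i j t sij /(t_ij_itv Xlr lr)[h1 h2 h3] /(p_ij_itv Xlr lr h2)[h4 h5].
  rewrite /is_last => /eqP jl.
  apply: add_right; [lia|lia|left; split].
  + by apply: (seg_ij_typ sij); lia.
  + by lia.
  + by move/typ_ji_lt; lia.
  + by move=> x; lia.
- move=> j i t i' sji /(t_ji_itv Xlr lr)[h1 h2 h3] /(p_ji_itv Xlr lr h2)[h4 h5] sij.
  have lij := seg_ltij sij.
  apply: add_left; [lia|lia|left; split].
  + by apply: (seg_ji_typ sji); lia.
  + by lia.
  + by apply: (typ_at_sink adm _).1; case: sij.
  + by move=> x hx; apply: (seg_ij_typ sij); lia.
- move=> j i t sji /(t_ji_itv Xlr lr)[h1 h2 h3] /(p_ji_itv Xlr lr h2)[h4 h5].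
  rewrite /is_first => /eqP jl.
  apply: add_left; [lia|lia|left; split].
  + by apply: (seg_ji_typ sji); lia.
  + by lia.
  + by move/typ_ij_lt; lia.
  + by move=> x; lia.
- move=> i j t p sij /(t_ij_itv Xlr lr)[h1 h2 h3] /(p_ij_itv Xlr lr h2)[h4 h5] pj.
  have tij x : i < x <= j -> ij x by exact: seg_ij_typ.
  have jn := ltn_ord j; apply: add_right; [lia|lia|left; split].
  + by apply: tij; lia.
  + by lia.
  + by move=> hji; apply: (typ_excl adm _ hji); apply: tij; lia.
  + by move=> x; lia.
- move=> j i t p sji /(t_ji_itv Xlr lr)[h1 h2 h3] /(p_ji_itv Xlr lr h2)[h4 h5] jp.
  have tji x : j < x <= i -> ji x by exact: seg_ji_typ.
  apply: add_left; [lia|lia|left; split].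
  + by apply: tji; lia.
  + by lia.
  + by move=> hij; apply: (typ_excl adm hij); apply: tji; lia.
  + by move=> x; lia.
Qed.

Let t_ijI (i j t : V) : i <= t <= j -> l <= t < r -> t = maxn i l :> nat ->
  t_ij X i j t.
Proof.
move=> h1 h2 h3; split; [by []|by rewrite (UD_itv Xlr)|].
by move=> s h4; rewrite (UD_itv Xlr); lia.
Qed.

Let t_jiI (j i t : V) : j <= t <= i -> l <= t < r -> t = minn i r.-1 :> nat ->
  t_ji X j i t.
Proof.
move=> h1 h2 h3; split; [by []|by rewrite (UD_itv Xlr)|].
by move=> s h4; rewrite (UD_itv Xlr); lia.
Qed.

Let p_ijI (j t p : V) : t < p <= j -> l <= t -> p = r :> nat -> p_ij X j t p.
Proof.
move=> h1 h2 h3; split; [by []|by rewrite (DU_itv Xlr); lia|].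
by move=> s h4; rewrite (DU_itv Xlr); lia.
Qed.

Let p_jiI (j t p : V) : j <= p < t -> t < r -> p.+1 = l -> p_ji X j t p.
Proof.
move=> h1 h2 h3; split; [by []|by rewrite (DU_itv Xlr); lia|].
by move=> s h4; rewrite (DU_itv Xlr); lia.
Qed.

(** The shifts that move an end exist.  Only the part of the label
    that tells which end moves is recorded; [shift_end_step] gives the rest. *)
Lemma add_left_shift : ji l -> exists F, shift I J X F (f_range F.1 F.2 X) /\ F.2.+1 = l.
Proof.
move=> [j [i [sji h]]]; have inn := ltn_ord i.
have tn : minn i r.-1 < n.-1 by lia.
have pn : l.-1 < n.-1 by lia.
pose t := Ordinal tn; pose p := Ordinal pn.
have tP : t_ji X j i t by apply: t_jiI => //=; lia.
have pP : p_ji X j t p by apply: p_jiI => //=; lia.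
have [jp|pj] := ltnP j p.
  by exists (p, p); split; [split=> //; exact: ES5_ji tP pP jp|move=> /=; lia].
have {pj} ep : p = j by apply: val_inj => /=; rewrite /= in pj; lia.
rewrite ep in pP; have [j0|j0] := boolP (is_first j).
  exists (j, j); split; first by split=> //; exact: ES4_ji_first tP pP j0.
  by rewrite -ep /=; lia.
have [|i' sij] := pred_j adm _ j0; first by case: sji.
exists (i', j); split; first by split=> //; exact: ES4_ji tP pP sij.
by rewrite -ep /=; lia.
Qed.

Lemma add_right_shift : ij r -> exists F, shift I J X F (f_range F.1 F.2 X) /\ F.1 = r :> nat.
Proof.
move=> [i [j [sij h]]]; have jn := ltn_ord j.
have tn : maxn i l < n.-1 by lia.
have pn : r < n.-1 by lia.
pose t := Ordinal tn; pose p := Ordinal pn.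
have tP : t_ij X i j t by apply: t_ijI => //=; lia.
have pP : p_ij X j t p by apply: p_ijI => //=; lia.
have [pj|jp] := ltnP p j.
  by exists (p, p); split; [split=> //; exact: ES5_ij tP pP pj|].
have {jp} ep : p = j by apply: val_inj => /=; rewrite /= in jp; lia.
rewrite ep in pP; have [j0|j0] := boolP (is_last j).
  by exists (j, j); split; [split=> //; exact: ES4_ij_last tP pP j0|rewrite -ep].
have [|i' sji] := succ_j adm _ j0; first by case: sij.
by exists (j, i'); split; [split=> //; exact: ES4_ij tP pP sji|rewrite -ep].
Qed.

Lemma remove_left_shift m : ~ ji l -> l < m < r -> ij m ->
  exists F, shift I J X F (f_range F.1 F.2 X) /\ F.2 < m.
Proof.
move=> lji lm mij.
have ln : l < n.-1 by lia.
pose l0 : V := Ordinal ln.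
(* if [l] is a source, the whole segment up to the next sink is removed *)
have source i : seg_ji I J l0 i -> exists F, shift I J X F (f_range F.1 F.2 X) /\ F.2 < m.
  move=> sji; have := seg_ltji sji => /= li; have im : i < m.
    rewrite ltnNge; apply/negP => mi; apply: (typ_excl adm mij).
    by apply: (seg_ji_typ sji) => /=; lia.
  have [| |j' sij] := @succ_i _ _ _ adm i; first by case: sji.
    by rewrite /is_last; lia.
  have i1n : i.+1 < n.-1 by lia.
  exists (l0, i); split=> //; split=> //; apply: (ES1_ji sji _ sij).
  - by move=> x /= hx; rewrite (UD_itv Xlr); lia.
  - exists (Ordinal i1n); first by have := seg_ltij sij => /=; lia.
    by move=> x /= hx; rewrite (UD_itv Xlr); lia.
  - by move=> i' _ y /= hy; rewrite (DU_itv Xlr); lia.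
have [l00|lpos] := posnP l.
  case: adm => _ _ _ [[z zC /eqP z0] _] _.
  have {z0} zl : z = l0 by apply: val_inj; rewrite /= l00.
  move: zC; rewrite zl inE => /orP[lI|lJ].
    have [|j sij] := succ_i adm lI; first by rewrite /is_last /=; lia.
    have lj := seg_ltij sij; exists (l0, l0); split; last by rewrite /=; lia.
    split=> //.
    apply: (ES2_ij (t := l0) sij); last by rewrite /is_first /= l00.
    by apply: t_ijI => //=; lia.
  have [|i sji] := succ_j adm lJ; first by rewrite /is_last /=; lia.
  exact: source sji.
have [i [j [sij hl]]] : ij l by apply: typ_ijN => //; lia.
have [lj|jl] := ltnP l j.
  exists (l0, l0); split; last by rewrite /=; lia.
    split=> //.
  apply: (ES3_ij (t := l0) sij) => /=; last by lia.
  by apply: t_ijI => /=; lia.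
have el : l0 = j by apply: val_inj => /=; lia.
have [||i' sji] := @succ_j _ _ _ adm l0; first by rewrite el; case: sij.
  by rewrite /is_last /=; lia.
exact: source sji.
Qed.

Lemma remove_right_shift m : ~ ij r -> l < m < r -> ji m ->
  exists F, shift I J X F (f_range F.1 F.2 X) /\ m <= F.1.
Proof.
move=> rij lm mji.
have rn : r.-1 < n.-1 by lia.
pose r0 : V := Ordinal rn.
have r0S : r0.+1 = r by rewrite /=; lia.
(* if [r-1] is a source, the whole segment down to the previous sink is removed *)
have source i : seg_ij I J i r0 -> exists F, shift I J X F (f_range F.1 F.2 X) /\ m <= F.1.
  move=> sij; have := seg_ltij sij => ir; have mi : m <= i.
    rewrite leqNgt; apply/negP => mi; apply: (typ_excl adm _ mji).
    by apply: (seg_ij_typ sij) => /=; lia.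
  have [| |j' sji] := @pred_i _ _ _ adm i; first by case: sij.
    by rewrite /is_first; lia.
  have i1n : i.-1 < n.-1 by lia.
  exists (i, r0); split=> //; split=> //; apply: (ES1_ij sij _ sji).
  - by move=> x hx; rewrite (UD_itv Xlr); lia.
  - exists (Ordinal i1n); first by have := seg_ltji sji => /=; lia.
    by move=> x /= hx; rewrite (UD_itv Xlr); lia.
  - by move=> i' _ y hy; rewrite (DU_itv Xlr); lia.
have [rN|rpos] := leqP n.-1 r.
  case: adm => _ _ _ [_ [z zC /eqP z0]] _.
  have {z0} zl : z = r0 by apply: val_inj => /=; lia.
  move: zC; rewrite zl inE => /orP[rI|rJ].
    have [|j sji] := pred_i adm rI; first by rewrite /is_first; lia.
    have lj := seg_ltji sji; exists (r0, r0); split; last by rewrite /=; lia.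
    split=> //.
    apply: (ES2_ji (t := r0) sji); last by rewrite /is_last; lia.
    by apply: t_jiI => //; lia.
  have [|i sij] := pred_j adm rJ; first by rewrite /is_first; lia.
  exact: source sij.
have [j [i [sji hl]]] : ji r by apply: typ_jiN => //; lia.
have [lj|jl] := ltnP j r0.
  exists (r0, r0); split; last by rewrite /=; lia.
    split=> //.
  apply: (ES3_ji (t := r0) sji); last by lia.
  by apply: t_jiI; lia.
have el : r0 = j by apply: val_inj => /=; rewrite /= in jl; lia.
have [||i' sij] := @pred_j _ _ _ adm r0; first by rewrite el; case: sji.
  by rewrite /is_first; lia.
exact: source sij.
Qed.

End OneStep.
End Steps.

(** * Shift paths between intervals *)

Section Moves.
Variables (n : nat) (I J : {set 'I_n.-1}).
Hypothesis adm : admissible I J.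
Local Open Scope nat_scope.
Local Notation V := 'I_n.-1.
Local Notation dyck := (dyck n).
Local Notation lnext := (lnext I J).
Local Notation rnext := (rnext I J).
Local Notation lkey := (lkey I J).
Local Notation rkey := (rkey I J).

Lemma dyck_ends (X : dyck) : 0 < n ->
  nth false X 0 = true /\ nth false X n.*2.-1 = false.
Proof.
move=> n0; case: X => y /= /is_dyckP[h1 h2]; split.
  by have := h2 1; rewrite big_nat1; case: (nth false y 0) => //; lia.
have := h2 n.*2.-1; move: h1.
rewrite -{1}[n.*2]prednK; last by lia.
by rewrite big_nat_recr //=; case: (nth false y n.*2.-1); lia.
Qed.

Lemma UD_interval_ext (X Y : dyck) l r :
  UD_interval X l r -> UD_interval Y l r -> X = Y.
Proof.
move=> hX hY; have [n0|n0] := posnP n.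
  apply: val_inj; apply: val_inj; apply: (@eq_from_nth _ false) => [|p].
    by rewrite !size_tuple.
  by rewrite size_tuple; lia.
have [X0 XL] := dyck_ends X n0; have [Y0 YL] := dyck_ends Y n0.
apply: val_inj; apply: val_inj; apply: (@eq_from_nth _ false) => [|p].
  by rewrite !size_tuple.
rewrite size_tuple => pn /=.
have [->|p0] := posnP p; first by rewrite X0 Y0.
have [->|pL] := eqVneq p n.*2.-1; first by rewrite XL YL.
have sn : (p.-1)./2 < n.-1 by lia.
have := hX (Ordinal sn); rewrite -(hY (Ordinal sn)) /block /= => -[e1 e2].
have [op|ep] := boolP (odd p).
  by have -> : p = (p.-1)./2.*2.+1 by lia.
by have -> : p = (p.-1)./2.*2.+2 by lia.
Qed.

Lemma UD_interval_inj (X : dyck) l r l' r' : l < r <= n.-1 -> l' < r' <= n.-1 ->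
  UD_interval X l r -> UD_interval X l' r' -> l = l' /\ r = r'.
Proof.
move=> lr lr' h h'.
have e x (xn : x < n.-1) : (l <= x < r) = (l' <= x < r').
  by rewrite -(UD_itv h (Ordinal xn)) -(UD_itv h' (Ordinal xn)).
have := e l; have := e l'; have := e r.-1; have := e r'.-1; lia.
Qed.

Section OneMove.
Variables (X : dyck) (l r : nat).
Hypotheses (Xlr : UD_interval X l r) (lr : l < r <= n.-1).

Lemma left_move m : lnext l m -> m < r ->
  exists F X', [/\ shift I J X F X', UD_interval X' m r & move_label l m F].
Proof.
move=> lm mr.
have [F [sh F2]] : exists F, shift I J X F (f_range F.1 F.2 X) /\ F.2.+1 < r.
  have [[h1 h2 h3 h4]|[h1 h2 h3 h4]] := lm.
    have [F [sh F2]] := add_left_shift adm Xlr lr h1.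
    by exists F; split=> //; lia.
  have [|F [sh F2]] := remove_left_shift adm Xlr lr h1 _ h3; first by lia.
  by exists F; split=> //; lia.
have sh' := sh; case: (shift_end_step adm Xlr lr sh).
- by move=> m' /(lnext_fun adm lm) <- _ X' Fm; exists F, (f_range F.1 F.2 X).
- by move=> m' _ _ _ [_ e]; lia.
have rn : r.-1 < n.-1 by lia.
move=> /(_ (Ordinal rn)); rewrite (shift_UD sh') /= ?(UD_itv Xlr) /=; lia.
Qed.

Lemma right_move m : rnext r m -> l < m ->
  exists F X', [/\ shift I J X F X', UD_interval X' l m & move_label r m F].
Proof.
move=> rm mr.
have [F [sh F1]] : exists F, shift I J X F (f_range F.1 F.2 X) /\ l < F.1.
  have [[h1 h2 h3 h4]|[h1 h2 h3 h4]] := rm.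
    have [F [sh F1]] := add_right_shift adm Xlr lr h1.
    by exists F; split=> //; lia.
  have [|F [sh F1]] := remove_right_shift adm Xlr lr h1 _ h3; first by lia.
  by exists F; split=> //; lia.
have sh' := sh; case: (shift_end_step adm Xlr lr sh).
- by move=> m' _ _ _ [e _]; lia.
- by move=> m' /(rnext_fun adm rm) <- _ X' Fm; exists F, (f_range F.1 F.2 X).
have ln : l < n.-1 by lia.
move=> /(_ (Ordinal ln)); rewrite (shift_UD sh') /= ?(UD_itv Xlr) /=; lia.
Qed.

End OneMove.

Lemma lnext_exists l l' : l < n.-1 -> l' < n.-1 -> lkey l < lkey l' ->
  exists m, lnext l m.
Proof.
move=> ln l'n; have := lkeyP adm l; case: (lkey l) / => [l1 l2 l3|l1 l2].
  move=> _; have ex : exists m, (m < l) && ~~ `[< typ_ij I J m >].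
    by exists 0; rewrite asboolF; [lia|move/typ_ij_lt].
  case: (@ex_maxnP _ l ex) => [x /andP[]|m /andP[h1 /asboolPn h2] hm]; first by lia.
  exists m; left; split=> // x hx; apply: contrapT => h.
  by have := hm x; rewrite asboolF //; lia.
have := lkeyP adm l'; case: (lkey l') / => [l3 l4 l5|l3 l4 lt]; first by lia.
have ex : exists m, (l < m) && `[< typ_ij I J m >].
  by exists l'; rewrite asboolT; [lia|apply: l4; lia].
case: (ex_minnP ex) => m /andP[h1 /asboolP h2] hm.
exists m; right; split=> // x hx; have mn := typ_ij_lt h2.
apply: (typ_jiN adm); first by lia.
by move=> h; have := hm x; rewrite asboolT //; lia.
Qed.

Lemma rnext_exists r r' : 0 < r <= n.-1 -> 0 < r' <= n.-1 -> rkey r < rkey r' ->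
  exists m, rnext r m.
Proof.
move=> rn r'n; have := rkeyP adm r; case: (rkey r) / => [l1 l2 l3|l1 l2].
  move=> _; have ex : exists m, (r < m) && ~~ `[< typ_ji I J m >].
    by exists n.-1; rewrite asboolF; [lia|move/typ_ji_lt; lia].
  case: (ex_minnP ex) => m /andP[h1 /asboolPn h2] hm.
  have mn : m <= n.-1 by apply: hm; rewrite asboolF; [lia|move/typ_ji_lt; lia].
  exists m; left; split=> // [|x hx]; first by lia.
  apply: contrapT => h.
  by have := hm x; rewrite asboolF //; lia.
have := rkeyP adm r'; case: (rkey r') / => [l3 l4 l5|l3 l4 lt]; first by lia.
have ex : exists m, (m < r) && `[< typ_ji I J m >].
  by exists r'; rewrite asboolT; [lia|apply: l4; lia].
case: (@ex_maxnP _ r ex) => [x /andP[]|m /andP[h1 /asboolP h2] hm]; first by lia.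
exists m; right; split=> // x hx; have mn := typ_ji_lt h2.
apply: (typ_ijN adm); first by lia.
by move=> h; have := hm x; rewrite asboolT //; lia.
Qed.

(** Two intervals that meet at [s] and whose ends are in the right order are
    joined by a shift path; [d] bounds the number of steps.  The intermediate
    intervals still contain [s], so that every move is available. *)
Lemma path_exists d (X Y : dyck) l r l' r' s :
  UD_interval X l r -> UD_interval Y l' r' ->
  l < r <= n.-1 -> l' < r' <= n.-1 -> l <= s < r -> l' <= s < r' ->
  lkey l <= lkey l' -> rkey r <= rkey r' ->
  lkey l' - lkey l + (rkey r' - rkey r) <= d -> inhabited (spath I J X Y).
Proof.
elim: d X l r => [|d IH] X l r hX hY lr lr' sX sY kl kr kd.
  have el : l = l' by apply: (lkey_inj adm); lia.
  have er : r = r' by apply: (rkey_inj adm); lia.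
  subst l' r'; rewrite (UD_interval_ext hX hY); constructor; exact: sp_nil.
have [kl'|kl'] := ltnP (lkey l) (lkey l').
  have [||m lm] := lnext_exists _ _ kl'; [lia|lia|].
  have [|mn km] := lnext_lt adm _ lm; first by lia.
  have km' : lkey m <= lkey l' by apply: (lnext_le adm _ _ lm); lia.
  have ml : m <= maxn l l' by apply: (lkey_between adm); lia.
  have [|F [X' [sh hX' _]]] := left_move hX lr lm; first by lia.
  have [|||||||p] := IH X' m r hX' hY; try by lia.
  by constructor; apply: sp_cons sh p.
have [kr'|kr'] := ltnP (rkey r) (rkey r'); last first.
  have el : l = l' by apply: (lkey_inj adm); lia.
  have er : r = r' by apply: (rkey_inj adm); lia.
  subst l' r'; rewrite (UD_interval_ext hX hY); constructor; exact: sp_nil.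
have [||m rm] := rnext_exists _ _ kr'; [lia|lia|].
have [|mn km] := rnext_lt adm _ rm; first by lia.
have km' : rkey m <= rkey r' by apply: (rnext_le adm _ _ rm); lia.
have ml : minn r r' <= m by apply: (rkey_between adm); lia.
have [|F [X' [sh hX' _]]] := right_move hX lr rm; first by lia.
have [|||||||p] := IH X' l m hX' hY; try by lia.
by constructor; apply: sp_cons sh p.
Qed.

Lemma spath_case (X Y : dyck) (p : spath I J X Y) :
  (exists e : X = Y, p = ecast Z (spath I J X Z) e (sp_nil I J X)) \/
  (exists F X' (sh : shift I J X F X') (p' : spath I J X' Y), p = sp_cons sh p').
Proof.
by case: p => [W|W F W' Z sh p]; [left; exists erefl|right; exists F, W', sh, p].
Qed.

(** A vertex common to both ends of a shift path that starts at an interval belongs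
    to its second member. *)
Lemma UD_first_step (X X' Y : dyck) F (sh : shift I J X F X') (p : spath I J X' Y) s :
  good X -> UD X s -> UD Y s -> UD X' s.
Proof.
move=> gX Xs Ys; apply: contraTT Ys => X's.
exact: (dropped_path adm p (drop_shift adm gX sh Xs X's)).
Qed.

Lemma path_keys (X Y : dyck) (p : spath I J X Y) l r l' r' s :
  UD_interval X l r -> UD_interval Y l' r' ->
  l < r <= n.-1 -> l' < r' <= n.-1 -> UD X s -> UD Y s ->
  lkey l <= lkey l' /\ rkey r <= rkey r'.
Proof.
move=> hX hY lr lr'; elim: p l r hX lr hY => [W|W F W' Z sh p IH] l r hX lr hY.
  by have [-> ->] := UD_interval_inj lr lr' hX hY.
move=> Ws Zs; have gW : good W by exists l, r; split=> //; lia.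
have W's := UD_first_step sh p gW Ws Zs.
case: (shift_end_step adm hX lr sh) => [m lm mr hW' _|m rm lm hW' _|/(_ s)].
- have [|mn km] := lnext_lt adm _ lm; first by lia.
  by have [|k1 k2] := IH m r hW' _ hY W's Zs; lia.
- have [|mn km] := rnext_lt adm _ rm; first by lia.
  by have [|k1 k2] := IH l m hW' _ hY W's Zs; lia.
by rewrite W's.
Qed.

Section Uniqueness.
Variables (Y : dyck) (l' r' : nat) (s : V).
Hypotheses (hY : UD_interval Y l' r') (lr' : l' < r' <= n.-1) (Ys : UD Y s).

(** The first step of a shift path from [l, r) to [Y] keeps [s] and moves one
    end, not beyond its final value. *)
Variant first_step l r (F : V * V) (X' : dyck) : Prop :=
| FirstLeft m of lnext l m & m <= s & lkey l < lkey m <= lkey l'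
    & UD_interval X' m r & move_label l m F
| FirstRight m of rnext r m & s < m <= n.-1 & rkey r < rkey m <= rkey r'
    & UD_interval X' l m & move_label r m F.

Lemma first_stepP (X X' : dyck) F l r : UD_interval X l r -> l < r <= n.-1 ->
  UD X s -> shift I J X F X' -> spath I J X' Y -> first_step l r F X'.
Proof.
move=> hX lr Xs sh p; have gX : good X by exists l, r; split=> //; lia.
have X's := UD_first_step sh p gX Xs Ys.
case: (shift_end_step adm hX lr sh) => [m lm mr hX' e|m rm lm hX' e|/(_ s)].
- have [|mn km] := lnext_lt adm _ lm; first by lia.
  have [|k1 k2] := path_keys p hX' hY _ lr' X's Ys; first by lia.
  apply: (FirstLeft lm) => //; last by lia.
  by move: X's; rewrite (UD_itv hX'); lia.
- have [|mn km] := rnext_lt adm _ rm; first by lia.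
  have [|k1 k2] := path_keys p hX' hY _ lr' X's Ys; first by lia.
  apply: (FirstRight rm) => //; last by lia.
  by move: X's; rewrite (UD_itv hX'); lia.
by rewrite X's.
Qed.

(** All shift paths between two intervals that meet are identified: the
    successive values of either end are forced, and a step at the left end
    commutes with a step at the right end.  The number [d] bounds the number of
    steps. *)
Lemma path_unique d (X : dyck) (p q : spath I J X Y) l r :
  UD_interval X l r -> l < r <= n.-1 -> UD X s ->
  lkey l' - lkey l + (rkey r' - rkey r) <= d -> sp_eq p q.
Proof.
elim: d X p q l r => [|d IH] X p q l r hX lr Xs kd.
  suff [e ->] : exists e : X = Y, p = ecast Z (spath I J X Z) e (sp_nil I J X).
    suff [e' ->] : exists e : X = Y, q = ecast Z (spath I J X Z) e (sp_nil I J X).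
      by rewrite (Prop_irrelevance e e'); exact: sp_refl.
    case: (spath_case q) => // -[F [X' [sh [q' _]]]].
    by case: (first_stepP hX lr Xs sh q'); lia.
  case: (spath_case p) => // -[F [X' [sh [p' _]]]].
  by case: (first_stepP hX lr Xs sh p'); lia.
(* If the first steps move different ends, both moves can be made one after the
   other, and a path [w] leads from the resulting interval to [Y]; compare each
   of the two paths with the one that ends with [w]. *)
have cross F X' (sh : shift I J X F X') (p' : spath I J X' Y) m
    G X'' (sh2 : shift I J X G X'') (q' : spath I J X'' Y) m2 :
    lnext l m -> m <= s -> lkey l < lkey m <= lkey l' ->
    UD_interval X' m r -> move_label l m F ->
    rnext r m2 -> s < m2 <= n.-1 -> rkey r < rkey m2 <= rkey r' ->
    UD_interval X'' l m2 -> move_label r m2 G ->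
    sp_eq (sp_cons sh p') (sp_cons sh2 q').
  move=> lm ms km hX' Fm rm ms2 km2 hX'' Gm.
  have ls : l <= s < r by rewrite -(UD_itv hX).
  have ls' : l' <= s < r' by rewrite -(UD_itv hY).
  have [||H [Z [sh3 hZ Hm]]] := right_move hX' _ rm; [lia|lia|].
  have [||H' [Z' [sh4 hZ' Hm']]] := left_move hX'' _ lm; [lia|lia|].
  have e1 := move_label_inj Gm Hm; have e2 := move_label_inj Fm Hm'.
  have e3 := UD_interval_ext hZ' hZ; subst H H' Z'.
  have [||||w] := path_exists hZ hY _ lr' _ ls' _ _ (leqnn _); try by lia.
  have h1 : sp_eq p' (sp_cons sh3 w).
    by apply: (IH _ _ _ m r) => //; rewrite ?(UD_itv hX'); lia.
  have h2 : sp_eq q' (sp_cons sh4 w).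
    by apply: (IH _ _ _ l m2) => //; rewrite ?(UD_itv hX''); lia.
  have ne : X' <> X''.
    move=> e; rewrite -e in hX''.
    by have [||em _] := UD_interval_inj _ _ hX' hX''; [lia|lia|rewrite em in km; lia].
  have c1 := sp_congr (sp_refl (sp_cons sh (sp_nil I J X'))) h1.
  have c2 := sp_congr (sp_refl (sp_cons sh2 (sp_nil I J X''))) h2.
  have sq := sp_congr (sp_square sh sh3 sh2 sh4 ne) (sp_refl w).
  exact: sp_trans c1 (sp_trans sq (sp_sym c2)).
case: (spath_case p) => [[e ->]|[F [X' [sh [p' ->]]]]].
  case: (spath_case q) => [[e' ->]|[F [X' [sh [q' _]]]]].
    by rewrite (Prop_irrelevance e e'); exact: sp_refl.
  rewrite e in hX; have [el er] := UD_interval_inj lr lr' hX hY.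
  by rewrite -e in hX; case: (first_stepP hX lr Xs sh q'); rewrite el er; lia.
case: (spath_case q) => [[e _]|[G [X'' [sh2 [q' ->]]]]].
  rewrite e in hX; have [el er] := UD_interval_inj lr lr' hX hY.
  by rewrite -e in hX; case: (first_stepP hX lr Xs sh p'); rewrite el er; lia.
have st2 := first_stepP hX lr Xs sh2 q'.
have ls : l <= s < r by rewrite -(UD_itv hX).
case: (first_stepP hX lr Xs sh p') => [m lm ms km hX' Fm|m rm ms km hX' Fm];
  case: st2 => [m2 lm2 ms2 km2 hX'' Gm|m2 rm2 ms2 km2 hX'' Gm].
- have e := lnext_fun adm lm lm2; subst m2; have eF := move_label_inj Fm Gm.
  have eX := UD_interval_ext hX' hX''; subst G X''.
  rewrite (Prop_irrelevance sh2 sh).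
  apply: (sp_congr (sp_refl (sp_cons sh (sp_nil I J X')))).
  by apply: (IH _ _ _ m r) => //; rewrite ?(UD_itv hX'); lia.
- exact: (cross _ _ sh p' m _ _ sh2 q' m2).
- by apply: sp_sym; exact: (cross _ _ sh2 q' m2 _ _ sh p' m).
- have e := rnext_fun adm rm rm2; subst m2; have eF := move_label_inj Fm Gm.
  have eX := UD_interval_ext hX' hX''; subst G X''.
  rewrite (Prop_irrelevance sh2 sh).
  apply: (sp_congr (sp_refl (sp_cons sh (sp_nil I J X')))).
  by apply: (IH _ _ _ l m) => //; rewrite ?(UD_itv hX'); lia.
Qed.

End Uniqueness.

End Moves.

(** * Morphisms between two intervals *)

Section SingleHom.
Variables (k : fieldType) (n : nat) (I J : {set 'I_n.-1}).
Hypothesis adm : admissible I J.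
Local Notation V := 'I_n.-1.
Local Notation dyck := (dyck n).

Lemma interval_good (X : dyck) l r : UD_interval X l r -> (l < r <= n.-1)%N -> good X.
Proof. by move=> hX lr; exists l, r; split=> //; lia. Qed.

Lemma Supp_UD (X : dyck) s : good X -> s \in Supp X -> UD X s.
Proof.
by case=> l [r [hX _ _]]; rewrite /UD inE hX; case: ifP.
Qed.

Lemma common_supp_src (X Y : dyck) (p : spath I J X Y) s :
  s \in common_supp p -> s \in Supp X.
Proof. by case: p => [W|W F W' Z sh p] //=; rewrite inE => /andP[]. Qed.

Lemma common_supp_tgt (X Y : dyck) (p : spath I J X Y) s :
  s \in common_supp p -> s \in Supp Y.
Proof. by elim: p => [W|W F W' Z sh p IH] //=; rewrite inE => /andP[_ /IH]. Qed.

Lemma theta_path_const (X Y : dyck) (p : spath I J X Y) s : good X ->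
  theta_path k p s = const_mx 1.
Proof.
elim: p => [W|W F W' Z sh p IH] gX /=.
  by apply/matrixP => i j; rewrite !mxE; case: (UD W s) i j => -[[|//] ?] [[|//] ?].
rewrite IH; last exact: good_shift gX sh.
rewrite /theta_step; case: ifP => Fs.
  rewrite mul0mx -[0]/(const_mx 0); apply: const_flat => /andP[Ws Zs]; exfalso.
  have := UD_first_step adm sh p gX Ws Zs; case: sh => _ ->.
  by move: Ws; rewrite /UD block_f_range Fs => /eqP ->.
rewrite const_mul; apply: const_flat => /andP[Ws Zs].
by rewrite (UD_first_step adm sh p gX Ws Zs).
Qed.

Section Pair.
Variables (X Y : dyck) (l r l' r' : nat).
Hypotheses (hX : UD_interval X l r) (hY : UD_interval Y l' r').
Hypotheses (lr : (l < r <= n.-1)%N) (lr' : (l' < r' <= n.-1)%N).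

Let gX : good X. Proof. exact: interval_good hX lr. Qed.
Let gY : good Y. Proof. exact: interval_good hY lr'. Qed.

(** The basis of Hom(X, Y) has at most one element, a class of shift paths that
    theta maps to the identity of k at every vertex common to X and Y. *)
Lemma theta_hom_inj (f g : dyck_hom k I J X Y) :
  (forall s, theta_hom f s = theta_hom g s) -> f = g.
Proof.
move=> fg; apply/malgP => b.
have /asboolP nz := valP b.
have [s hs] := set0Pn _ (nz (rpr (val b))).
have Xs : UD X s by apply: Supp_UD gX _; exact: common_supp_src hs.
have Ys : UD Y s by apply: Supp_UD gY _; exact: common_supp_tgt hs.
have one (c : hom_basis I J X Y) : c = b.
  apply: val_inj; rewrite -(rprK (val c)) -(rprK (val b)); apply/clsP.
  exact: (path_unique adm hY lr' Ys _ _ hX lr Xs (leqnn _)).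
have E (h : dyck_hom k I J X Y) : theta_hom h s = h@_b *: const_mx 1.
  rewrite /theta_hom (@lift_sub _ _ _ _ _ [fset b]%fset); last first.
    by apply/fsubsetP => c _; rewrite (one c) inE.
  by rewrite big_seq_fset1 theta_path_const.
have /matrixP := fg s; rewrite !E.
move: Xs Ys; case: (UD X s); case: (UD Y s) => // _ _ /(_ ord0 ord0).
by rewrite !mxE !mulr1.
Qed.

(** A morphism between two interval representations. *)
Section Full.
Variable A : forall s : V, 'M[k]_(UD X s, UD Y s).
Hypothesis Acomm : forall u v, Q_arrow I J u v ->
  (const_mx 1 : 'M_(UD X u, UD X v)) *m A v = A u *m const_mx 1.

(* [c s] is the scalar by which the morphism acts at [s], and 0 if one of the two
   spaces vanishes; [cN] extends it by 0 to all natural numbers. *)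
Let c (s : V) : k := \sum_i \sum_j A s i j.
Let cN (x : nat) : k := oapp c 0 (insub x).

Let A_c s : A s = const_mx (c s).
Proof.
rewrite /c; move: (A s); case: (UD X s); case: (UD Y s) => B;
  apply/matrixP => -[[|//] i0] [[|//] j0] //.
by rewrite mxE !big_ord1; congr (B _ _); apply: val_inj.
Qed.

Let c0 s : ~~ (UD X s && UD Y s) -> c s = 0.
Proof.
rewrite /c; move: (A s); case: (UD X s); case: (UD Y s) => B // _.
- by rewrite big1 // => i _; rewrite big_ord0.
- by rewrite big_ord0.
- by rewrite big_ord0.
Qed.

Let cNE (s : V) : cN s = c s.
Proof. by rewrite /cN valK. Qed.

Let cN0 x : ~~ ((l <= x < r) && (l' <= x < r'))%N -> cN x = 0.
Proof.
rewrite /cN; case: insubP => //= s _ <- h; apply: c0.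
by rewrite (UD_itv hX) (UD_itv hY).
Qed.

Let c_arrow u v : Q_arrow I J u v -> UD X u -> UD Y v -> c v = c u.
Proof.
move=> uv Xu Yv; have := Acomm uv; rewrite !A_c.
have := @c0 u; have := @c0 v; rewrite Xu Yv andbT /=.
case: (UD X v) => h1; case: (UD Y u) => h2 /matrixP/(_ ord0 ord0);
  rewrite !mxE ?big_ord0 ?big_ord1 ?mxE ?mulr1 ?mul1r //.
- by rewrite h2.
- by rewrite h1.
- by rewrite h1 // h2.
Qed.

Let cN_ij x : typ_ij I J x.+1 -> (l <= x.+1 < r)%N -> (l' <= x < r')%N ->
  cN x = cN x.+1.
Proof.
move=> xij hx hx'; have xn := typ_ij_lt xij.
have un : (x.+1 < n.-1)%N by lia.
have vn : (x < n.-1)%N by lia.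
rewrite (cNE (Ordinal un)) (cNE (Ordinal vn)); apply: c_arrow.
- by apply/Q_arrowE; left.
- by rewrite (UD_itv hX).
- by rewrite (UD_itv hY).
Qed.

Let cN_ji x : typ_ji I J x.+1 -> (l <= x < r)%N -> (l' <= x.+1 < r')%N ->
  cN x.+1 = cN x.
Proof.
move=> xji hx hx'; have xn := typ_ji_lt xji.
have vn : (x.+1 < n.-1)%N by lia.
have un : (x < n.-1)%N by lia.
rewrite (cNE (Ordinal un)) (cNE (Ordinal vn)); apply: c_arrow.
- by apply/Q_arrowE; right.
- by rewrite (UD_itv hX).
- by rewrite (UD_itv hY).
Qed.

Let cN_succ x : (maxn l l' <= x)%N -> (x.+1 < minn r r')%N -> cN x.+1 = cN x.
Proof.
move=> h1 h2; have [|t|t] := @typ_total _ _ _ adm x.+1; first by lia.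
  by apply/esym/cN_ij => //; lia.
by apply: cN_ji => //; lia.
Qed.

Let cN_const x : (maxn l l' <= x < minn r r')%N -> cN x = cN (maxn l l').
Proof.
move=> hx; have -> : x = (maxn l l' + (x - maxn l l'))%N by lia.
have : (maxn l l' + (x - maxn l l') < minn r r')%N by lia.
elim: (x - maxn l l')%N => [|m IH] hm; first by rewrite addn0.
by rewrite addnS cN_succ ?IH //; lia.
Qed.

(* If the scalar is nonzero, the arrow across the left end of the intersection
   points the way that prevents [l] from coming after [l']. *)
Let lkeys : cN (maxn l l') != 0 -> (maxn l l' < minn r r')%N ->
  (lkey I J l <= lkey I J l')%N.
Proof.
move=> nz hK; case: (ltngtP l l') => ll'; last by rewrite ll'.
- have [x ex] : exists x, l' = x.+1 by exists l'.-1; lia.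
  have t : typ_ij I J l'.
    apply: (typ_ijN adm); first by lia.
    move=> t; move: nz; rewrite (maxn_idPr _) ?(ltnW ll') // ex cN_ji -?ex //; try lia.
    by rewrite cN0 ?eqxx //; lia.
  by case: (lkeyP adm l'); case: (lkeyP adm l); try lia; move=> *; case: (typ_excl adm t).
- have [x ex] : exists x, l = x.+1 by exists l.-1; lia.
  have t : typ_ji I J l.
    apply: (typ_jiN adm); first by lia.
    move=> t; move: nz; rewrite (maxn_idPl _) ?(ltnW ll') // ex -cN_ij -?ex //; try lia.
    by rewrite cN0 ?eqxx //; lia.
  by rewrite (lkey_ji t); case: (lkeyP adm l'); lia.
Qed.

Let rkeys : cN (maxn l l') != 0 -> (maxn l l' < minn r r')%N ->
  (rkey I J r <= rkey I J r')%N.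
Proof.
move=> nz hK; have {}nz : cN (minn r r').-1 != 0 by rewrite cN_const //; lia.
case: (ltngtP r r') => rr'; last by rewrite rr'.
- have [x ex] : exists x, r = x.+1 by exists r.-1; lia.
  have t : typ_ij I J r.
    apply: (typ_ijN adm); first by lia.
    move=> t; move: nz; rewrite (minn_idPl _) ?(ltnW rr') // ex /= -cN_ji -?ex //; try lia.
    by rewrite cN0 ?eqxx //; lia.
  by rewrite (rkey_ij t); case: (rkeyP adm r'); lia.
- have [x ex] : exists x, r' = x.+1 by exists r'.-1; lia.
  have t : typ_ji I J r'.
    apply: (typ_jiN adm); first by lia.
    move=> t; move: nz; rewrite (minn_idPr _) ?(ltnW rr') // ex /= cN_ij -?ex //; try lia.
    by rewrite cN0 ?eqxx //; lia.
  by case: (rkeyP adm r'); case: (rkeyP adm r); try lia; move=> *; case: (typ_excl adm _ t).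
Qed.

(** A nonzero morphism is a multiple of the image of a shift path. *)
Lemma theta_hom_surj : exists f : dyck_hom k I J X Y, forall s, theta_hom f s = A s.
Proof.
have [z|/existsNP[s /eqP nz]] := EM (forall s, c s = 0).
  exists 0 => s; rewrite A_c z /theta_hom /free_lift msupp0 big_nil.
  by apply/matrixP => i j; rewrite !mxE.
have sK : (l <= s < r)%N && (l' <= s < r')%N.
  by apply: contraR nz => /cN0; rewrite cNE => ->.
have [Xs Ys] : UD X s /\ UD Y s by rewrite (UD_itv hX) (UD_itv hY); lia.
have cs : cN (maxn l l') = c s by rewrite -cNE [RHS]cN_const //; lia.
rewrite -cs in nz.
have [p] : inhabited (spath I J X Y).
  apply: (path_exists (s := s) adm hX hY lr lr' _ _ (lkeys nz _) (rkeys nz _)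
    (leqnn _)); lia.
have nv : nonvanishing I J X Y.
  by move=> q; apply/set0Pn; exists s; exact: (UD_path adm).
exists (cN (maxn l l') *: sp_hom k (cls p)) => u.
have -> f : theta_hom (cN (maxn l l') *: f) u = cN (maxn l l') *: theta_hom (f : dyck_hom k I J X Y) u.
  by have := theta_hom_linear u (cN (maxn l l')) f 0; rewrite addr0 => ->;
    rewrite {2}/theta_hom /free_lift msupp0 big_nil addr0.
rewrite theta_hom_cls // theta_path_const // A_c.
have -> : cN (maxn l l') *: const_mx 1 = const_mx (cN (maxn l l')) :> 'M[k]_(UD X u, UD Y u).
  by apply/matrixP => i j; rewrite !mxE mulr1.
apply: const_flat; rewrite (UD_itv hX) (UD_itv hY) => hu.
by rewrite -cNE [RHS]cN_const //; lia.
Qed.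

End Full.
End Pair.
End SingleHom.

(** * Theta is fully faithful *)

Section FullyFaithful.
Variables (k : fieldType) (n : nat) (I J : {set 'I_n.-1}).
Hypotheses (adm : admissible I J) (n0 : (0 < n)%N).
Local Notation V := 'I_n.-1.
Local Notation C := (S_category k I J).

Lemma mx_linfun_inj m m' : injective (@mx_linfun k m m').
Proof.
move=> A B /lfunP AB; apply/row_matrixP => i; rewrite !rowE.
by have := AB (delta_mx 0 i); rewrite !lfunE.
Qed.

Lemma mx_linfun_surj m m' (h : 'Hom('rV[k]_m, 'rV[k]_m')) :
  exists A, h = mx_linfun A.
Proof. by exists (lin1_mx h); apply/lfunP => u; rewrite lfunE /= mul_rV_lin1. Qed.

Lemma Theta_faithful : faithful_functor (Theta k adm).
Proof.
move=> X Y f g fg; apply: functional_extensionality_dep => a.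
apply: functional_extensionality_dep => b.
have [l [r [lr hX]]] := in_S_interval n0 (svalP X a).
have [l' [r' [lr' hY]]] := in_S_interval n0 (svalP Y b).
apply: (theta_hom_inj adm hX hY lr lr') => s.
have := congr1 (fun h : @rep_hom k (Q I J) _ _ => h s) fg => /mx_linfun_inj.
by move/eq_mxblockP => /(_ a b).
Qed.

Lemma Theta_full : full_functor (Theta k adm).
Proof.
move=> X Y h.
pose dX s a := UD (sval X a) s : nat; pose dY s b := UD (sval Y b) s : nat.
pose A s : 'M[k]_(\sum_a dX s a, \sum_b dY s b) :=
  projT1 (cid (mx_linfun_surj (rep_comp h s))).
have hA s : rep_comp h s = mx_linfun (A s).
  exact: projT2 (cid (mx_linfun_surj (rep_comp h s))).
have blocks a b : exists f : dyck_hom k I J (sval X a) (sval Y b),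
    forall s, theta_hom f s = submxblock (A s) a b.
  have [l [r [lr hX]]] := in_S_interval n0 (svalP X a).
  have [l' [r' [lr' hY]]] := in_S_interval n0 (svalP Y b).
  apply: (theta_hom_surj adm hX hY lr lr') => u v uv.
  have := @rep_comm _ _ _ _ h u v uv; rewrite /= !hA !mx_linfun_comp.
  move/mx_linfun_inj; rewrite -[A u]submxblockK -[A v]submxblockK !mul_mxblock.
  move/eq_mxblockP => /(_ a b).
  rewrite (bigD1 a) //= eqxx big1 ?addr0; last first.
    by move=> a' /negPf; rewrite eq_sym => ->; rewrite mul0mx.
  rewrite (bigD1 b) //= eqxx big1 ?addr0; last first.
    by move=> b' /negPf ->; rewrite mulmx0.
  by rewrite !mxblockK.
exists (fun a b => projT1 (cid (blocks a b))).
apply: rep_hom_eq => s; rewrite hA /= /theta_mor; congr mx_linfun.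
rewrite -[RHS]submxblockK; apply: eq_mxblock => a b.
exact: projT2 (cid (blocks a b)) s.
Qed.

End FullyFaithful.

(** * Dyck paths of S with a prescribed interval *)

Section IntervalWord.
Variables (n l r : nat).
Hypothesis lr : (l < r <= n.-1)%N.
Local Open Scope nat_scope.

(* Letter [p] of the path: after the initial [U], the letters at the odd position
   2s+1 and at 2s+2 form the block at [s]; at the last position 2n-1 the block
   index is n-1, outside the interval, which gives [D]. *)
Let g p := (p == 0) || (odd p == (l <= p.-1./2 < r)).

Let g0 : g 0. Proof. by []. Qed.
Let gO s : g s.*2.+1 = (l <= s < r).
Proof. by rewrite /g /= odd_double doubleK; case: (_ && _). Qed.
Let gE s : g s.*2.+2 = ~~ (l <= s < r).
Proof. by rewrite /g /= odd_double /= uphalf_double; case: (_ && _). Qed.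

Let y : (n.*2).-tuple bool := [tuple of mkseq g n.*2].

Let nthy p : p < n.*2 -> nth false y p = g p.
Proof. by move=> pn; rewrite nth_mkseq. Qed.

Let sumE s : \sum_(0 <= p < s.*2.+1) g p = s.+1.
Proof.
elim: s => [|s IH]; first by rewrite big_nat1.
by rewrite doubleS big_nat_recr //= big_nat_recr //= IH gO gE; case: (_ && _); lia.
Qed.

Let y_dyck : is_dyck y.
Proof.
have S m : m <= n.*2 ->
    \sum_(0 <= p < m) nth false y p = \sum_(0 <= p < m) g p.
  move=> mn; rewrite big_nat [RHS]big_nat; apply: eq_bigr => p pm.
  by rewrite nthy //; lia.
apply/is_dyckP; split.
  rewrite S //; have -> : n.*2 = n.-1.*2.+2 by lia.
  by rewrite big_nat_recr //= sumE gO; lia.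
move=> m mn; rewrite S //; case: m mn => // m mn.
have [om|em] := boolP (odd m); last first.
  have -> : m.+1 = m./2.*2.+1 by lia.
  by rewrite sumE; lia.
have -> : m.+1 = m./2.*2.+2 by lia.
by rewrite big_nat_recr //= sumE; lia.
Qed.

(** Every interval of vertices is the support of a Dyck path with n - 1 peaks. *)
Lemma interval_dyck : exists2 X : dyck n, in_S X & UD_interval X l r.
Proof.
exists (Dyck y_dyck); last first.
  move=> s; have sn := ltn_ord s; rewrite /block !nthy; [|lia|lia].
  by rewrite gO gE; case: (_ && _).
rewrite /in_S /peaks -sum1_count big_mkcond /=.
have -> : iota 0 n.*2.-1 = index_iota 0 n.*2.-1 by rewrite /index_iota subn0.
transitivity (\sum_(0 <= p < n.*2.-1) (g p && ~~ g p.+1)).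
  rewrite big_nat [RHS]big_nat; apply: eq_bigr => p pn.
  by rewrite !nthy; [case: (g p) (g p.+1) => -[]|lia|lia].
have P s : \sum_(0 <= p < s.*2.+1) (g p && ~~ g p.+1) = s + (s < l).
  elim: s => [|s IH].
    by rewrite big_nat1 g0 (gO 0); lia.
  rewrite doubleS big_nat_recr //= big_nat_recr //= IH gO gE (gO s.+1).
  by lia.
have -> : n.*2.-1 = n.-1.*2.+1 by lia.
by rewrite P; lia.
Qed.

End IntervalWord.

(** * Decomposition of representations into intervals *)

Section IntervalBasis.
Variables (k : fieldType) (n : nat) (I J : {set 'I_n.-1}).
Hypothesis adm : admissible I J.
Local Notation V := 'I_n.-1.
Local Notation Q := (Q I J).
Variable M : rep k Q.

Section Basis.
Variables (m : nat) (T : finType) (L R : T -> nat) (e : T -> forall s : V, M s).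

(** Over the vertices below [m], the representation [M] is the direct sum of the
    interval representations on [L a, R a), embedded by the generators [e a s]:
    at each vertex [s] the [e a s] with [s] in [L a, R a) form a basis of [M s],
    the others vanish, and an arrow maps [e a u] to [e a v], in particular to 0
    when it leaves the interval. *)
Record interval_basis : Prop := IntervalBasis {
  ib_itv : forall a, (L a < R a <= m)%N;
  ib_out : forall a (s : V), ~~ (L a <= s < R a)%N -> e a s = 0;
  ib_span : forall s : V, (s < m)%N -> forall x : M s,
    exists c : T -> k, x = \sum_a c a *: e a s;
  ib_free : forall s : V, (s < m)%N -> forall c : T -> k,
    \sum_a c a *: e a s = 0 -> forall a, (L a <= s < R a)%N -> c a = 0;
  ib_map : forall (u v : V) (h : arrow (q := Q) u v), (u < m)%N -> (v < m)%N ->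
    forall a, (L a <= u < R a)%N -> rep_map M h (e a u) = e a v }.

End Basis.

(** The restriction of [M] to the vertices below [m] is a finite direct sum of
    interval representations. *)
Definition has_interval_basis (m : nat) : Prop :=
  exists (T : finType) (L R : T -> nat) (e : T -> forall s : V, M s),
    interval_basis m L R e.

Section Replace.
Variables (m : nat) (T : finType) (L R : T -> nat) (e : T -> forall s : V, M s).
Hypothesis ib : interval_basis m L R e.
Variables (a : T) (c : T -> k).
Hypothesis ca : c a != 0.
Hypothesis cP : forall b, c b != 0 ->
  R b = m /\ (lkey I J (L a) <= lkey I J (L b))%N.

Let e' (b : T) (s : V) : M s :=
  if b == a then
    if (L a <= s < R a)%N then \sum_b c b *: e b s else 0
  else e b s.

Let e'_out (s : V) : ~~ (L a <= s < R a)%N -> forall b, e' b s = e b s.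
Proof.
move=> sa b; rewrite /e'; case: eqP => // ->.
by rewrite (negPf sa) (ib_out ib).
Qed.

Let e'_sum (s : V) (d : T -> k) : (L a <= s < R a)%N ->
  \sum_b d b *: e' b s = \sum_b (d a * c b + (b != a)%:R * d b) *: e b s.
Proof.
move=> sa; rewrite (bigD1 a) //= {1}/e' eqxx sa scaler_sumr.
under [RHS]eq_bigr do rewrite scalerDl -scalerA.
rewrite big_split /=; congr (_ + _).
rewrite [RHS](bigD1 a) //= eqxx mul0r scale0r add0r.
by apply: eq_bigr => b /negPf ba; rewrite /e' ba mul1r.
Qed.

(** The generator [a] may be replaced by a combination, with a nonzero
    coefficient at [a], of generators of intervals that end at [m] as its own does
    and whose left ends do not come before [L a]: such intervals receive a nonzero
    morphism from [L a, m). *)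
Lemma interval_basis_replace : interval_basis m L R e'.
Proof.
have [Ra _] := cP ca; have lrm := ib_itv ib.
split.
- exact: ib_itv ib.
- move=> b s sb; rewrite /e'; case: eqP => [ba|_]; last exact: ib_out ib _ _ sb.
  by rewrite -ba (negPf sb).
- move=> s sm x; have [D ->] := ib_span ib sm x.
  have [sa|sa] := boolP (L a <= s < R a)%N; last first.
    by exists D; apply: eq_bigr => b _; rewrite e'_out.
  exists (fun b => if b == a then D a / c a else D b - D a / c a * c b).
  rewrite e'_sum // eqxx; apply: eq_bigr => b _; congr (_ *: _).
  case: eqVneq => [->|_]; first by rewrite mul0r addr0 divfK.
  by rewrite mul1r addrC subrK.
- move=> s sm d; have [sa|sa] := boolP (L a <= s < R a)%N; last first.
    move=> h; apply: (ib_free ib sm); rewrite -[RHS]h.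
    by apply: eq_bigr => b _; rewrite e'_out.
  rewrite e'_sum // => /(ib_free ib sm) h.
  have da : d a = 0.
    have /eqP := h a sa; rewrite eqxx mul0r addr0 mulf_eq0 (negPf ca) orbF.
    by move/eqP.
  move=> b sb; have [->//|ba] := eqVneq b a.
  by have := h b sb; rewrite da ba mul0r add0r mul1r.
move=> u v h um vm b ub; rewrite /e'; case: eqP => [eb|_]; last first.
  exact: (ib_map ib h um vm ub).
subst b; rewrite ub linear_sum /=.
have [va|va] := boolP (L a <= v < R a)%N.
  apply: eq_bigr => b _; rewrite linearZ /=.
  have [->|/cP[Rb kb]] := eqVneq (c b) 0; first by rewrite !scale0r.
  congr (_ *: _); have [ub'|ub'] := boolP (L b <= u < R b)%N.
    exact: (ib_map ib h um vm ub').
  rewrite (ib_out ib ub') linear0 (ib_out ib) //.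
  apply/negP => vb; move/Q_arrowE: h => [[e1 t]|[e1 t]]; first by lia.
  have eL : L b = v :> nat by lia.
  have := typ_ji_lt t; move: kb; rewrite eL (lkey_ji t).
  by case: (lkeyP adm (L a)); lia.
rewrite big1 // => b _; rewrite linearZ /=.
have [->|/cP[Rb kb]] := eqVneq (c b) 0; first by rewrite scale0r.
have [ub'|ub'] := boolP (L b <= u < R b)%N; last first.
  by rewrite (ib_out ib ub') linear0 scaler0.
rewrite (ib_map ib h um vm ub') (ib_out ib) ?scaler0 //.
apply/negP => vb; move/Q_arrowE: h => [[e1 t]|[e1 t]]; last by lia.
have eL : L a = u :> nat by lia.
have lb : (L b < L a)%N by lia.
move: kb; rewrite eL; case: (lkeyP adm u) => [j _ _|_ _].
  by case: (typ_excl adm t j).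
by case: (lkeyP adm (L b)); lia.
Qed.

End Replace.

(** A subspace of the last space is spanned by some of the generators, after a
    suitable change of them. *)
Lemma interval_basis_adapt m (v : V) (T : finType) (L R : T -> nat)
    (W : {vspace M v}) : v.+1 = m ->
  (exists e : T -> forall s : V, M s, interval_basis m L R e) ->
  exists e : T -> forall s : V, M s, interval_basis m L R e /\
    forall z, z \in W -> exists c : T -> k,
      (forall a, c a != 0 -> (L a <= v < R a)%N /\ e a v \in W) /\
      z = \sum_a c a *: e a v.
Proof.
move=> vm [e ib].
(* Induction on the number of generators alive at [v] that lie outside [W]. *)
pose bad (e : T -> forall s : V, M s) := [pred a | (L a <= v < R a)%N && (e a v \notin W)].
have [d] := ubnP #|bad e|; elim: d e ib => // d IH e ib; rewrite ltnS => bd.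
have [good_e|] := EM (forall z, z \in W -> exists c : T -> k,
      (forall a, c a != 0 -> (L a <= v < R a)%N /\ e a v \in W) /\
      z = \sum_a c a *: e a v); first by exists e.
move=> /existsNP[z /not_implyP[zW nz]].
have v_m : (v < m)%N by lia.
have [c zc] := ib_span ib v_m z.
pose c1 a := if bad e a then c a else 0.
pose c2 a := if (L a <= v < R a)%N && (e a v \in W) then c a else 0.
have z12 : z = \sum_a c1 a *: e a v + \sum_a c2 a *: e a v.
  rewrite {1}zc -big_split /=; apply: eq_bigr => a _; rewrite -scalerDl.
  have [av|av] := boolP (L a <= v < R a)%N.
    by congr (_ *: _); rewrite /c1 /c2 /= av /=; case: (_ \in W); rewrite ?add0r ?addr0.
  by rewrite (ib_out ib av) !scaler0.
have z1W : \sum_a c1 a *: e a v \in W.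
  rewrite -(addrK (\sum_a c2 a *: e a v) (\sum_a c1 a *: e a v)) -z12 rpredB //.
  apply: rpred_sum => a _; rewrite /c2; case: ifP => [/andP[_ ?]|_].
    by rewrite rpredZ.
  by rewrite scale0r rpred0.
have [a0 a0c] : exists a, c1 a != 0.
  apply: contrapT => /forallNP h; apply: nz; exists c2; split.
    by move=> a; rewrite /c2; case: ifP => [/andP[]|_]; rewrite ?eqxx.
  rewrite z12 big1 ?add0r // => a _.
  by have /negP/negPn/eqP -> := h a; rewrite scale0r.
(* The part of [z] carried by generators outside [W] lies in [W]; it replaces the
   generator with the earliest left end among those that occur in it. *)
case: (@arg_minnP _ a0 [pred a | c1 a != 0] (fun a => lkey I J (L a)) a0c).
move=> a /= ac amin.
have abad : bad e a by move: ac; rewrite /c1; case: (bad e a); rewrite ?eqxx.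
have cP b : c1 b != 0 -> R b = m /\ (lkey I J (L a) <= lkey I J (L b))%N.
  move=> bc; split; last exact: amin.
  have : bad e b by move: bc; rewrite /c1; case: (bad e b); rewrite ?eqxx.
  by move=> /andP[vb _]; have := ib_itv ib b; lia.
have ib' := interval_basis_replace ib ac cP.
apply: IH ib' _; apply: leq_trans bd; apply: proper_card; apply/properP; split.
  apply/subsetP => b; rewrite !inE; case: eqVneq => // -> /andP[av].
  by rewrite av z1W.
exists a; first exact: abad.
by rewrite inE eqxx; move: abad => /andP[av _]; rewrite av /= negbK.
Qed.

(** Data at one more vertex [w]: the generators in [S] take the values [x] there,
    and the [y i] start new intervals. *)
Section Extend.
Variables (m : nat) (T : finType) (L R : T -> nat) (e : T -> forall s : V, M s).
Hypothesis ib : interval_basis m L R e.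
Variables (w : V) (S : pred T) (x : T -> M w) (q : nat) (y : 'I_q -> M w).
Hypothesis wm : w = m :> nat.
Hypothesis SR : forall a, S a -> R a = m.
Hypothesis x_in : forall (u : V) (h : arrow (q := Q) u w), (u < m)%N ->
  forall a, (L a <= u < R a)%N -> rep_map M h (e a u) = if S a then x a else 0.
Hypothesis x_out : forall (u : V) (h : arrow (q := Q) w u), (u < m)%N ->
  forall a, S a -> rep_map M h (x a) = e a u.
Hypothesis y_out : forall (u : V) (h : arrow (q := Q) w u), (u < m)%N ->
  forall i, rep_map M h (y i) = 0.
Hypothesis xy_span : forall z : M w, exists (c : T -> k) (d : 'I_q -> k),
  z = \sum_(a | S a) c a *: x a + \sum_i d i *: y i.
Hypothesis xy_free : forall (c : T -> k) (d : 'I_q -> k),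
  \sum_(a | S a) c a *: x a + \sum_i d i *: y i = 0 ->
  (forall a, S a -> c a = 0) /\ (forall i, d i = 0).

Let L' (t : T + 'I_q) : nat := match t with inl a => L a | inr _ => m end.
Let R' (t : T + 'I_q) : nat :=
  match t with inl a => if S a then m.+1 else R a | inr _ => m.+1 end.
Let e' (t : T + 'I_q) : forall s : V, M s :=
  match t with
  | inl a => dfwith (e a) (if S a then x a else 0)
  | inr i => dfwith (fun _ => 0) (y i)
  end.

Let ws (s : V) : (s < m)%N -> w != s.
Proof. by move=> sm; rewrite -(inj_eq val_inj) /=; lia. Qed.

Let sum_lt (c : T + 'I_q -> k) (s : V) : (s < m)%N ->
  \sum_t c t *: e' t s = \sum_a c (inl a) *: e a s.
Proof.
move=> sm; rewrite big_sumType /= [X in _ + X]big1 ?addr0.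
  by apply: eq_bigr => a _; rewrite dfwith_out ?ws.
by move=> i _; rewrite dfwith_out ?ws // scaler0.
Qed.

Let sum_w (c : T + 'I_q -> k) :
  \sum_t c t *: e' t w =
  \sum_(a | S a) c (inl a) *: x a + \sum_i c (inr i) *: y i.
Proof.
rewrite big_sumType /=; congr (_ + _); last by apply: eq_bigr => i _; rewrite dfwith_in.
rewrite [RHS]big_mkcond; apply: eq_bigr => a _; rewrite dfwith_in.
by case: (S a); rewrite ?scaler0.
Qed.

Let cases_w (s : V) : (s < m.+1)%N -> s = w \/ (s < m)%N.
Proof.
rewrite ltnS leq_eqVlt -wm => /orP[/eqP h|h]; [left|by right].
exact: val_inj.
Qed.

Lemma interval_basis_extend : has_interval_basis m.+1.
Proof.
exists (T + 'I_q)%type, L', R', e'; have lrm := ib_itv ib; split.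
- case=> [a|i] /=; last by lia.
  by have := lrm a; case: ifP => [/SR|_]; lia.
- case=> [a|i] s /= h.
    have := lrm a; have [e1|sw] := eqVneq w s.
      subst s; rewrite dfwith_in => ?.
      by case: ifP h => //; have := @SR a => hS /hS; lia.
    rewrite dfwith_out // => ?; apply: (ib_out ib); move: h.
    have {}sw : s != w :> nat by rewrite eq_sym in sw; rewrite (inj_eq val_inj).
    by case: ifP => // /SR; lia.
  rewrite dfwith_out //; apply: contra h => /eqP <-; lia.
- move=> s /cases_w[->|sm] z.
    have [c [d ->]] := xy_span z.
    by exists (fun t => match t with inl a => c a | inr i => d i end); rewrite sum_w.
  have [c ->] := ib_span ib sm z.
  exists (fun t => if t is inl a then c a else 0).
  by rewrite sum_lt.
- move=> s /cases_w[->|sm] c.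
    rewrite sum_w => /xy_free[h1 h2] [a|i] //= h.
    by apply: (h1 a); move: h; have := lrm a; case: ifP => //; lia.
  rewrite sum_lt // => /(ib_free ib sm) h [a|i] /= hs; last by lia.
  apply: (h a); move: hs; have := lrm a; case: ifP => // /SR; lia.
move=> u v h /cases_w[eu|um] /cases_w[ev|vm] [a|i] /= hu.
- by subst u v; exfalso; move/Q_arrowE: h; lia.
- by subst u v; exfalso; move/Q_arrowE: h; lia.
- subst u; rewrite dfwith_in dfwith_out ?ws //.
  case: ifP hu => [Sa _|_]; first exact: x_out.
  by have := lrm a; lia.
- by subst u; rewrite dfwith_in dfwith_out ?ws // y_out.
- subst v; rewrite dfwith_in dfwith_out ?ws //; apply: x_in => //.
  by move: hu; have := lrm a; case: ifP => // /SR; lia.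
- by lia.
- rewrite !dfwith_out ?ws //; apply: (ib_map ib) => //.
  by move: hu; have := lrm a; case: ifP => // /SR; lia.
- by lia.
Qed.

End Extend.

Lemma subspace_basis (vT : vectType k) (U : {vspace vT}) :
  exists (q : nat) (y : 'I_q -> vT), [/\ forall i, y i \in U,
    forall z, z \in U -> exists d : 'I_q -> k, z = \sum_i d i *: y i &
    forall d : 'I_q -> k, \sum_i d i *: y i = 0 -> forall i, d i = 0].
Proof.
exists (\dim U), (fun i => (vbasis U)`_i); split.
- by move=> i; apply: vbasis_mem; apply: mem_nth; rewrite size_tuple.
- by move=> z /coord_vbasis; exists (coord (vbasis U) ^~ z).
- exact: (freeP (basis_free (vbasisP U))).
Qed.

Lemma arrow_irrelevance (u v : V) (h h' : arrow (q := Q) u v) : h = h'.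
Proof. exact: (@Prop_irrelevance (Q_arrow I J u v) h h'). Qed.

Lemma interval_basis_step m : (m < n.-1)%N ->
  has_interval_basis m -> has_interval_basis m.+1.
Proof.
move=> mn [T [L [R [e0 ib0]]]]; pose w : V := Ordinal mn.
have [m0|m0] := posnP m.
  have [q [y [_ yspan yfree]]] := subspace_basis (fullv : {vspace M w}).
  apply: (interval_basis_extend ib0 (w := w) (S := pred0) (x := fun _ => 0) (y := y));
    rewrite ?m0 //.
    move=> z; have [d ->] := yspan z (memvf z).
    by exists (fun _ => 0), d; rewrite big_pred0_eq add0r.
  by move=> c d; rewrite big_pred0_eq add0r => /yfree.
have vn : (m.-1 < n.-1)%N by lia.
pose v : V := Ordinal vn.
have vm : v.+1 = m by rewrite /=; lia.
have v_m : (v < m)%N by rewrite -vm.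
have adj_v (u : V) : (u < m)%N -> u.+1 = w \/ w.+1 = u -> u = v.
  by move=> um [] /= h; apply: val_inj => /=; lia.
have [|mij|mji] := @typ_total _ _ _ adm m; first by lia.
(* Arrow [w -> v]: the generators in its image are lifted to [w], and a basis of
   its kernel starts new intervals. *)
- have h0 : arrow (q := Q) w v by apply/Q_arrowE; left.
  have [e [ib ad]] := interval_basis_adapt (limg (rep_map M h0)) vm (ex_intro _ _ ib0).
  have lrm := ib_itv ib.
  have [q [y [yU yspan yfree]]] := subspace_basis (lker (rep_map M h0)).
  pose S : pred T := [pred a | (R a == m) && (e a v \in limg (rep_map M h0))].
  have Sv a : S a -> (L a <= v < R a)%N.
    by move=> /andP[/eqP Ra _]; have := lrm a; lia.
  pose x a := ((rep_map M h0)^-1)%VF (e a v).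
  have xK a : S a -> rep_map M h0 (x a) = e a v.
    by move=> /andP[_ ?]; rewrite limg_lfunVK.
  have mapx (c : T -> k) : rep_map M h0 (\sum_(a | S a) c a *: x a) =
      \sum_a (if S a then c a else 0) *: e a v.
    rewrite linear_sum big_mkcond /=; apply: eq_bigr => a _.
    have := @xK a; case: (S a) => [xa|_]; last by rewrite scale0r.
    by rewrite linearZ /= xa.
  have mapy (d : 'I_q -> k) : rep_map M h0 (\sum_i d i *: y i) = 0.
    rewrite linear_sum big1 // => i _; rewrite linearZ /=.
    have /eqP -> : rep_map M h0 (y i) == 0 by rewrite -memv_ker.
    by rewrite scaler0.
  have no_in (u : V) : arrow (q := Q) u w -> (u < m)%N -> False.
    move=> /Q_arrowE[[e1 _]|[e1 t]] um; first by move: e1 => /=; lia.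
    by move: t => /=; exact: typ_excl mij.
  have out (u : V) (h : arrow (q := Q) w u) : (u < m)%N -> u = v.
    by move=> um; apply: adj_v => //; move/Q_arrowE: h => [[-> _]|[-> _]]; [left|right].
  apply: (interval_basis_extend ib (w := w) (S := S) (x := x) (y := y)) => //.
  - by move=> a /andP[/eqP].
  - by move=> u h /(no_in u h).
  - move=> u h um a Sa; have eu := out u h um; subst u.
    by rewrite (arrow_irrelevance h h0) xK.
  - move=> u h um i; have eu := out u h um; subst u.
    by rewrite (arrow_irrelevance h h0); apply/eqP; rewrite -memv_ker.
  - move=> z; have [c [cS zc]] := ad _ (memv_img (rep_map M h0) (memvf z)).
    have zK : z - \sum_(a | S a) c a *: x a \in lker (rep_map M h0).
      rewrite memv_ker linearB /= zc mapx subr_eq0; apply/eqP/eq_bigr => a _.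
      congr (_ *: _); case: ifP => // Sa.
      have [//|/cS[h1 h2]] := eqVneq (c a) 0.
      by move: Sa; rewrite /S /= h2 andbT; have := lrm a; lia.
    have [d hd] := yspan _ zK; exists c, d.
    by rewrite -hd addrC subrK.
  - move=> c d h; have c0 a : S a -> c a = 0.
      move=> Sa; have := congr1 (rep_map M h0) h.
      rewrite linear0 linearD /= mapx mapy addr0 => /(ib_free ib v_m)/(_ a (Sv a Sa)).
      by rewrite Sa.
    split=> //; apply: yfree; rewrite -[RHS]h [X in X + _]big1 ?add0r // => a /c0 ->.
    by rewrite scale0r.
(* Arrow [v -> w]: the generators outside its kernel are pushed to [w], and a
   basis of a complement of its image starts new intervals. *)
- have h0 : arrow (q := Q) v w by apply/Q_arrowE; right.
  have [e [ib ad]] := interval_basis_adapt (lker (rep_map M h0)) vm (ex_intro _ _ ib0).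
  have lrm := ib_itv ib.
  have [q [y [yU yspan yfree]]] := subspace_basis ((limg (rep_map M h0))^C)%VS.
  pose x a := rep_map M h0 (e a v).
  pose S : pred T := [pred a | (R a == m) && (x a != 0)].
  have Sv a : S a -> (L a <= v < R a)%N.
    by move=> /andP[/eqP Ra _]; have := lrm a; lia.
  have mapx (c : T -> k) : \sum_(a | S a) c a *: x a =
      rep_map M h0 (\sum_a (if S a then c a else 0) *: e a v).
    rewrite linear_sum big_mkcond /=; apply: eq_bigr => a _.
    by case: (S a); rewrite linearZ //= scale0r.
  have xS a : (L a <= v < R a)%N -> x a = if S a then x a else 0.
    move=> va; case: ifP => //; rewrite /S /=.
    have -> : R a = m by have := lrm a; lia.
    by rewrite eqxx /= => /negbFE/eqP.
  have no_out (u : V) : arrow (q := Q) w u -> (u < m)%N -> False.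
    move=> /Q_arrowE[[e1 t]|[e1 t]] um; last by move: e1 => /=; lia.
    by move: t => /= t; exact: typ_excl t mji.
  have inn (u : V) (h : arrow (q := Q) u w) : (u < m)%N -> u = v.
    by move=> um; apply: adj_v => //; move/Q_arrowE: h => [[-> _]|[-> _]]; [right|left].
  apply: (interval_basis_extend ib (w := w) (S := S) (x := x) (y := y)) => //.
  - by move=> a /andP[/eqP].
  - move=> u h um a ua; have eu := inn u h um; subst u.
    by rewrite (arrow_irrelevance h h0) -xS.
  - by move=> u h /(no_out u h).
  - by move=> u h /(no_out u h).
  - move=> z; have : z \in (limg (rep_map M h0) + (limg (rep_map M h0))^C)%VS.
      by rewrite addv_complf memvf.
    move=> /memv_addP[_ /memv_imgP[t _ ->] [z2 /yspan[d ->] ->]].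
    have [c ->] := ib_span ib v_m t; exists c, d; congr (_ + _).
    rewrite mapx !linear_sum; apply: eq_bigr => a _; rewrite !linearZ /= -/(x a).
    have [va|va] := boolP (L a <= v < R a)%N; last first.
      by rewrite /x (ib_out ib va) linear0 !scaler0.
    by rewrite [x a]xS //; case: (S a); rewrite ?scaler0.
  - move=> c d h.
    have h1 : \sum_(a | S a) c a *: x a = 0.
      apply/eqP; rewrite -memv0 -(capv_compl (limg (rep_map M h0))) memv_cap.
      rewrite {1}mapx memv_img ?memvf //=.
      move/eqP: h; rewrite addr_eq0 => /eqP ->; rewrite rpredN.
      by apply: rpred_sum => i _; rewrite rpredZ.
    split; last by apply: yfree; rewrite -[RHS]h h1 add0r.
    move=> a Sa; move: h1; rewrite mapx => /eqP; rewrite -memv_ker => /ad[c' [c'S]].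
    move=> /eqP; rewrite -subr_eq0 -sumrB.
    under eq_bigr do rewrite -scalerBl.
    move=> /eqP/(ib_free ib v_m)/(_ a (Sv a Sa)); rewrite Sa.
    have [->|/c'S[_]] := eqVneq (c' a) 0; first by rewrite subr0.
    by rewrite memv_ker => /eqP xa; move: Sa; rewrite /S /= /x xa eqxx andbF.
Qed.

Lemma interval_basis_exists : has_interval_basis n.-1.
Proof.
suff ind m : (m <= n.-1)%N -> has_interval_basis m by exact: ind (leqnn _).
elim: m => [_|m IH mn]; last first.
  by apply: interval_basis_step => //; apply: IH; exact: ltnW.
exists void, (fun _ => 0%N), (fun _ => 0%N), (fun t => of_void _ t).
by split=> // -[].
Qed.

End IntervalBasis.

(** * Theta is an equivalence *)

Section EssentiallySurjective.
Variables (k : fieldType) (n : nat) (I J : {set 'I_n.-1}).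
Hypothesis adm : admissible I J.
Local Notation V := 'I_n.-1.
Local Notation Q := (Q I J).
Local Notation C := (S_category k I J).

Lemma rep_hom_bij_iso (M N : rep_category k Q) (h : hom M N) :
  (forall s, lker (h s) = 0%VS) -> (forall s, limg (h s) = fullv) -> is_iso h.
Proof.
move=> inj surj.
have hK s : cancel (h s) (h s)^-1%VF by apply: lker0_lfunK; rewrite inj.
have hKV s : cancel (h s)^-1%VF (h s).
  by move=> x; rewrite limg_lfunVK // surj memvf.
have comm (u v : Q) (a : arrow u v) :
    ((h v)^-1 \o rep_map N a = rep_map M a \o (h u)^-1)%VF.
  apply/lfunP => y; rewrite !comp_lfunE.
  rewrite -{1}(hKV u y) -[rep_map N a _]comp_lfunE -rep_comm comp_lfunE.
  exact: hK.
exists (RepHom comm); split; apply: rep_hom_eq => s; apply/lfunP => x /=.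
  by rewrite comp_lfunE id_lfunE hK.
by rewrite comp_lfunE id_lfunE hKV.
Qed.

Lemma row_bool0 (b : bool) (B : 'rV[k]_b) : \sum_j B 0 j = 0 -> B = 0.
Proof.
case: b B => B; last by move=> _; apply/matrixP => ? [].
by rewrite big_ord1 => B0; apply/matrixP => i j; rewrite mxE -[RHS]B0 !ord1.
Qed.

Section Iso.
Variables (M : rep k Q) (T : finType) (L R : T -> nat).
Variable e : T -> forall s : V, M s.
Hypothesis ib : interval_basis n.-1 L R e.
Variable D : T -> dyck n.
Hypothesis DS : forall a, in_S (D a).
Hypothesis Ditv : forall a, UD_interval (D a) (L a) (R a).

Let XD : formal_sum (dyck_lincategory k I J) :=
  @FormalSum _ (dyck_lincategory k I J) #|T| (fun i => D (enum_val i)).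
Let XS : S_sum XD. Proof. by move=> i; exact: DS. Qed.
Let X : C := exist _ XD XS.

(* The coordinate of [x] in the [i]-th block, which has width 0 or 1. *)
Let coord_at (s : V) (i : 'I_#|T|) (x : 'rV[k]_(\sum_i UD (D (enum_val i)) s)) : k :=
  \sum_j submxrow x i 0 j.

Let eta_fun (s : V) (x : 'rV[k]_(\sum_i UD (D (enum_val i)) s)) : M s :=
  \sum_i coord_at i x *: e (enum_val i) s.

Let eta_linear s : linear (@eta_fun s).
Proof.
move=> a x y; rewrite /eta_fun scaler_sumr -big_split /=; apply: eq_bigr => i _.
rewrite scalerA -scalerDl; congr (_ *: _).
rewrite /coord_at mulr_sumr -big_split /=; apply: eq_bigr => j _.
by rewrite !mxE.
Qed.

HB.instance Definition _ s := GRing.isLinear.Build k _ _ _ (@eta_fun s) (@eta_linear s).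

Let eta (s : V) : 'Hom(theta_obj XD s, M s) := linfun (@eta_fun s).

Let etaE (s : V) x : eta s x = \sum_i coord_at i x *: e (enum_val i) s.
Proof. by rewrite lfunE. Qed.

Let coord_at0 (s : V) (i : 'I_#|T|) (x : 'rV[k]_(\sum_i UD (D (enum_val i)) s)) :
  ~~ UD (D (enum_val i)) s -> coord_at i x = 0.
Proof.
rewrite /coord_at => h; rewrite big1 // => j; exfalso; move: h.
by case: j => j; case: UD.
Qed.

Let alive (i : 'I_#|T|) (s : V) : UD (D (enum_val i)) s = (L (enum_val i) <= s < R (enum_val i))%N.
Proof. exact: UD_itv (Ditv _) s. Qed.

Let reidx (N : nmodType) (F : T -> N) : \sum_a F a = \sum_(i < #|T|) F (enum_val i).
Proof. by rewrite (reindex (fun i : 'I_#|T| => enum_val i)) //; exact: onW_bij (enum_val_bij T). Qed.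

Let eta_comm (u v : Q) (h : arrow u v) :
  (eta v \o rep_map (theta_obj XD) h = rep_map M h \o eta u)%VF.
Proof.
apply/lfunP => x; rewrite !comp_lfunE !etaE linear_sum; apply: eq_bigr => i _.
rewrite linearZ /=.
have -> : coord_at i (mx_linfun (\mxblock_(a, b) (if a == b then const_mx 1 else 0
    : 'M_(UD (D (enum_val a)) u, UD (D (enum_val b)) v))) x) =
    coord_at i x *+ UD (D (enum_val i)) v.
  rewrite /coord_at lfunE /= -[x in LHS]submxrowK mul_mxrow_mxblock mxrowK.
  rewrite (bigD1 i) //= eqxx [X in _ + X]big1 ?addr0; last first.
    by move=> a /negPf ->; rewrite mulmx0.
  under eq_bigr do rewrite mxE; under eq_bigr do under eq_bigr do
    rewrite [const_mx _ _ _]mxE mulr1.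
  by rewrite sumr_const card_ord.
have [ui|ui] := boolP (UD (D (enum_val i)) u); last first.
  by rewrite coord_at0 // mul0rn !scale0r.
rewrite (ib_map ib) ?ltn_ord -?alive //.
have [vi|vi] := boolP (UD (D (enum_val i)) v); first by rewrite mulr1n.
by rewrite (ib_out ib) -?alive // !scaler0.
Qed.

Let eta_inj (s : V) : lker (eta s) = 0%VS.
Proof.
apply/eqP/lker0P => x y /eqP; rewrite -subr_eq0 -linearB /= => /eqP h.
apply/eqP; rewrite -subr_eq0; move: (x - y) h => {x y} z.
rewrite etaE => h; apply/eqP/mxrowP => i; rewrite submxrow0.
apply: row_bool0; rewrite -/(coord_at i z).
have [si|/coord_at0 -> //] := boolP (UD (D (enum_val i)) s).
have := ib_free ib (ltn_ord s) (c := fun a => coord_at (enum_rank a) z).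
rewrite reidx; under eq_bigr do rewrite enum_valK.
by move=> /(_ h (enum_val i)); rewrite -alive enum_valK => /(_ si).
Qed.

Let eta_surj (s : V) : limg (eta s) = fullv.
Proof.
apply/eqP; rewrite eqEsubv subvf; apply/subvP => z _.
have [c ->] := ib_span ib (ltn_ord s) z; apply/memv_imgP.
exists (\mxrow_i const_mx (c (enum_val i))); first exact: memvf.
rewrite etaE reidx; apply: eq_bigr => i _.
rewrite /coord_at mxrowK; under eq_bigr do rewrite mxE.
rewrite sumr_const card_ord.
have [si|si] := boolP (UD (D (enum_val i)) s); first by rewrite mulr1n.
by rewrite (ib_out ib) -?alive // !scaler0.
Qed.

(** The interval basis defines an isomorphism from the image under Theta of the
    sum of the paths [D a] to [M]. *)
Lemma interval_basis_iso :
  exists X : C, exists f : hom (Theta k adm X) (M : rep_category k Q),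
  is_iso f.
Proof.
exists X; exists (RepHom eta_comm); apply: rep_hom_bij_iso => s /=.
  exact: eta_inj.
exact: eta_surj.
Qed.

End Iso.

Lemma Theta_essentially_surjective : essentially_surjective (Theta k adm).
Proof.
move=> M; have [T [L [R [e ib]]]] := interval_basis_exists adm M.
have D0 a : exists X : dyck n, in_S X /\ UD_interval X (L a) (R a).
  by have [X XS hX] := interval_dyck (ib_itv ib a); exists X.
apply: (@interval_basis_iso M T L R e ib (fun a => projT1 (cid (D0 a)))) => a.
  by case: (projT2 (cid (D0 a))).
by case: (projT2 (cid (D0 a))).
Qed.

End EssentiallySurjective.

Theorem theorem15 (k : fieldType) (n : nat) (hn : (3 <= n)%N)
    (I J : {set 'I_n.-1}) (hIJ : admissible I J) :
  is_equivalence (Theta k hIJ).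
Proof.
have n0 : (0 < n)%N by exact: ltn_trans hn.
apply: equivalence_of_fully_faithful.
- exact: Theta_faithful.
- exact: Theta_full.
- exact: Theta_essentially_surjective.
Qed.
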